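(* Let $(U,A)$ be a left bialgebroid, with right dual $U^*$ and left dual $U_*$. (i) If $(U,A)$ is moreover a left Hopf algebroid, there is a morphism $$S^*:U^*\to U_*,\qquad S^*(\phi)(u)=\epsilon\big(u_+\,t^\ell(\phi(u_-))\big),$$ of $A^e$-rings with augmentation; if, in addition, both ${}_{\triangleright}U$ and $U_{\triangleleft}$ are finitely generated $A$-projective, then $(S^*,\mathrm{id}_A)$ is a morphism of right bialgebroids. (ii) If $(U,A)$ is a right Hopf algebroid instead, there is a morphism $$S_*:U_*\to U^*,\qquad S_*(\psi)(u)=\epsilon\big(u_{[+]}\,s^\ell(\psi(u_{[-]}))\big),$$ of $A^e$-rings with augmentation; if, in addition, both ${}_{\triangleright}U$ and $U_{\triangleleft}$ are finitely generated $A$-projective, then $(S_*,\mathrm{id}_A)$ is a morphism of right bialgebroids. (iii) If $(U,A)$ is simultaneously a left and a right Hopf algebroid, then the two morphisms $S^*$ and $S_*$ are inverse to each other; hence, if both ${}_{\triangleright}U$ and $U_{\triangleleft}$ are finitely generated $A$-projective, then $U^*\simeq U_*$ as right bialgebroids.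
   Context: $k$ is a commutative ring, unadorned $\otimes$ is over $k$, $A$ is an associative unital $k$-algebra, $A^e=A\otimes A^{\rm op}$. An $A^e$-ring $U$ is a $k$-algebra with a $k$-algebra map $\eta:A^e\to U$; put $s^\ell(a)=\eta(a\otimes1)$ (source), $t^\ell(a)=\eta(1\otimes a)$ (target). Write $$a\triangleright u\triangleleft b:=s^\ell(a)t^\ell(b)u,\qquad a\blacktriangleright u\blacktriangleleft b:=u\,t^\ell(a)s^\ell(b),$$ and ${}_{\triangleright}U,\ U_{\triangleleft},\ {}_{\blacktriangleright}U,\ U_{\blacktriangleleft}$ for $U$ with the corresponding $A$-action. Thus in $U_{\triangleleft}\otimes_A{}_{\triangleright}U$ one has $t^\ell(a)u\otimes u'=u\otimes s^\ell(a)u'$. Its Takeuchi product $U_{\triangleleft}\times_A{}_{\triangleright}U$ consists of the $\sum_i u_i\otimes u_i'$ with $\sum_i u_it^\ell(a)\otimes u_i'=\sum_i u_i\otimes u_i's^\ell(a)$ for all $a\in A$; it is an algebra under factorwise multiplication. A left bialgebroid $(U,A)$ is an $A^e$-ring $U$ with an $A$-coring structure (coassociative coproduct $\Delta_\ell:U\to U_{\triangleleft}\otimes_A{}_{\triangleright}U$, $u\mapsto u_{(1)}\otimes_A u_{(2)}$, and counit $\epsilon:U\to A$, both bimodule maps for the $(A,A)$-bimodule ${}_{\triangleright}U_{\triangleleft}$) such that $\Delta_\ell$ is a unital $k$-algebra map into $U_{\triangleleft}\times_A{}_{\triangleright}U$, and $\epsilon(1)=1$, $\epsilon(uu')=\epsilon(u\,s^\ell(\epsilon(u')))=\epsilon(u\,t^\ell(\epsilon(u')))$.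 A right bialgebroid $(V,B,s^r,t^r,\Delta_r,\partial)$ is a datum such that $(V^{\rm op},B,t^r,s^r,\Delta_r,\partial)$ (source $t^r$, target $s^r$) is a left bialgebroid; thus $\Delta_r:V\to V_{\blacktriangleleft}\otimes_B{}_{\blacktriangleright}V$, $v\mapsto v^{(1)}\otimes v^{(2)}$, with $v\,s^r(b)\otimes v'=v\otimes v'\,t^r(b)$. Morphisms of bialgebroids are pairs of algebra maps (on total and base algebras) commuting with source, target, coproduct and counit. Hopf–Galois maps: $$\alpha_\ell:{}_{\blacktriangleright}U\otimes_{A^{\rm op}}U_{\triangleleft}\to U_{\triangleleft}\otimes_A{}_{\triangleright}U,\ u\otimes v\mapsto u_{(1)}\otimes u_{(2)}v,$$ $$\alpha_r:U_{\blacktriangleleft}\otimes^A{}_{\triangleright}U\to U_{\triangleleft}\otimes_A{}_{\triangleright}U,\ u\otimes v\mapsto u_{(1)}v\otimes u_{(2)},$$ where in the first domain $ut^\ell(a)\otimes v=u\otimes t^\ell(a)v$ and in the second $us^\ell(a)\otimes v=u\otimes s^\ell(a)v$. $U$ is a left (right) Hopf algebroid if $\alpha_\ell$ ($\alpha_r$) is bijective; then $u_+\otimes_{A^{\rm op}}u_-:=\alpha_\ell^{-1}(u\otimes_A1)$, respectively $u_{[+]}\otimes^Au_{[-]}:=\alpha_r^{-1}(1\otimes_Au)$. Duals: the right dual is $U^*:=\mathrm{Hom}_{A^{\rm op}}(U_{\triangleleft},A)$ (maps with $\phi(t^\ell(a)u)=\phi(u)a$) and the left dual is $U_*:=\mathrm{Hom}_A({}_{\triangleright}U,A)$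 (maps with $\psi(s^\ell(a)u)=a\psi(u)$). Both are $A^e$-rings with unit $\epsilon$ and with augmentation (''counit'') given by evaluation at $1_U$: - $U^*$: $(\phi\phi')(u)=\phi'\big(s^\ell(\phi(u_{(1)}))u_{(2)}\big)$, source $s_r^*(a)(u)=\epsilon(u\,s^\ell(a))$, target $t_r^*(a)(u)=a\,\epsilon(u)$, $\partial^*(\phi)=\phi(1_U)$; - $U_*$: $(\psi\psi')(u)=\psi'\big(t^\ell(\psi(u_{(2)}))u_{(1)}\big)$, source $s^r_*(a)(u)=\epsilon(u)a$, target $t^r_*(a)(u)=\epsilon(u\,t^\ell(a))$, $\partial_*(\psi)=\psi(1_U)$. A morphism of $A^e$-rings with augmentation is a unital algebra map compatible with source, target and augmentation. If $U_{\triangleleft}$ is finitely generated projective, $U^*$ is a right bialgebroid over $A$ with counit $\partial^*$ and coproduct determined by $\phi(uu')=\phi^{(1)}\big(u\,t^\ell(\phi^{(2)}(u'))\big)$; if ${}_{\triangleright}U$ is finitely generated projective, $U_*$ is a right bialgebroid over $A$ with counit $\partial_*$ and coproduct determined by $\psi(uu')=\psi^{(2)}\big(u\,s^\ell(\psi^{(1)}(u'))\big)$. *)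

(* Defs.v *)
From HB Require Import structures.
From mathcomp Require Import all_boot all_algebra.
From mathcomp Require Import boolp classical_sets functions.

Set Implicit Arguments.
Unset Strict Implicit.
Unset Printing Implicit Defensive.

Import GRing.Theory.
Local Open Scope ring_scope.
Local Open Scope quotient_scope.

Section OppositeAlgebra.
Variables (k : comPzRingType) (V : algType k).

HB.instance Definition _ := GRing.Zmodule_isLmodule.Build k V^c
  (@scalerA _ V) (@scale1r _ V) (@scalerDr _ V) (@scalerDl _ V).

HB.instance Definition _ := GRing.LSemiModule_isLSemiAlgebra.Build k V^c
  (fun c u v => @scalerAr k V c v u).

HB.instance Definition _ := GRing.LSemiAlgebra_isSemiAlgebra.Build k V^c
  (fun c u v => @scalerAl k V c v u).

End OppositeAlgebra.

Section Tensor.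
Variables (M N : zmodType) (B : Type) (ract : M -> B -> M) (lact : B -> N -> N).

(* The tensor product over [B] of a right and a left [B]-action on abelian
   groups: formal sums of pairs modulo biadditivity and balancedness.  Inverses
   need no formal sign, since [(- m) ⊗ n] is opposite to [m ⊗ n]. *)
Inductive tensor_rel : seq (M * N) -> seq (M * N) -> Prop :=
| tensor_refl x : tensor_rel x x
| tensor_sym x y : tensor_rel x y -> tensor_rel y x
| tensor_trans x y z : tensor_rel x y -> tensor_rel y z -> tensor_rel x z
| tensor_cat x x' y y' :
    tensor_rel x x' -> tensor_rel y y' -> tensor_rel (x ++ y) (x' ++ y')
| tensor_catC x y : tensor_rel (x ++ y) (y ++ x)
| tensor_0l n : tensor_rel [:: (0, n)] [::]
| tensor_Dl m m' n : tensor_rel [:: (m + m', n)] [:: (m, n); (m', n)]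
| tensor_Dr m n n' : tensor_rel [:: (m, n + n')] [:: (m, n); (m, n')]
| tensor_bal m b n : tensor_rel [:: (ract m b, n)] [:: (m, lact b n)].

Definition tensor_relb : rel (seq (M * N)) := fun x y => `[< tensor_rel x y >].

Lemma tensor_relb_equiv : equiv_class_of tensor_relb.
Proof.
split=> [x|x y|y x z]; first exact/asboolP/tensor_refl.
  by apply/asboolP/asboolP; apply: tensor_sym.
by move=> /asboolP xy /asboolP yz; apply/asboolP/(tensor_trans xy yz).
Qed.

Canonical tensor_equiv := EquivRelPack tensor_relb_equiv.

Definition tensor := {eq_quot tensor_equiv}.
HB.instance Definition _ := Choice.on tensor.
HB.instance Definition _ := EqQuotient.on tensor.

Lemma tensor_eqP (x y : seq (M * N)) :
  tensor_rel x y -> \pi_tensor x = \pi_tensor y.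
Proof. by move=> xy; apply/eqmodP/asboolP. Qed.

Lemma tensor_reprP (x : seq (M * N)) : tensor_rel (repr (\pi_tensor x)) x.
Proof.
suff /asboolP : tensor_equiv (repr (\pi_tensor x)) x by [].
by apply/eqmodP; rewrite reprK.
Qed.

Definition tensor_zero : tensor := \pi_tensor [::].
Definition tensor_add (x y : tensor) : tensor := \pi_tensor (repr x ++ repr y).
Definition tensor_opp (x : tensor) : tensor :=
  \pi_tensor [seq (- p.1, p.2) | p <- repr x].

Lemma tensor_addE (x y : seq (M * N)) :
  tensor_add (\pi_tensor x) (\pi_tensor y) = \pi_tensor (x ++ y).
Proof. by apply/tensor_eqP/tensor_cat; apply: tensor_reprP. Qed.

Lemma tensor_addA : associative tensor_add.
Proof.
move=> x y z; have e w : w = \pi_tensor (repr w) by rewrite reprK.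
by rewrite (e x) (e y) (e z) [tensor_add _ (\pi_tensor (repr z))]tensor_addE
  [tensor_add (\pi_tensor (repr x)) (\pi_tensor (repr y))]tensor_addE [LHS]tensor_addE
  [RHS]tensor_addE catA.
Qed.

Lemma tensor_addC : commutative tensor_add.
Proof.
by move=> x y; rewrite -[x]reprK -[y]reprK !tensor_addE; apply/tensor_eqP/tensor_catC.
Qed.

Lemma tensor_add0 : left_id tensor_zero tensor_add.
Proof. by move=> x; rewrite -[x]reprK tensor_addE. Qed.

Lemma tensor_addN : left_inverse tensor_zero tensor_opp tensor_add.
Proof.
move=> x; rewrite -{2}[x]reprK tensor_addE; apply: tensor_eqP.
elim: (repr x) => [|[m n] r IH] /=; first exact: tensor_refl.
set w := map _ _.
have wr : tensor_rel (w ++ ([:: (m, n)] ++ r)) ([:: (m, n)] ++ (w ++ r)).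
  by rewrite !catA; apply: tensor_cat (tensor_refl _); apply: tensor_catC.
apply: (tensor_trans (tensor_cat (tensor_refl [:: (- m, n)]) wr)).
rewrite catA -[X in tensor_rel _ X]cat0s; apply: tensor_cat IH.
apply: tensor_trans (tensor_0l n); rewrite -(addNr m).
by apply: tensor_sym; apply: tensor_Dl.
Qed.

HB.instance Definition _ :=
  GRing.isZmodule.Build tensor tensor_addA tensor_addC tensor_add0 tensor_addN.

Definition tens (m : M) (n : N) : tensor := \pi_tensor [:: (m, n)].

(* The map induced by [f], computed on a representative: it depends only on the
   tensor when [f] is balanced, see [tlift_pi] and [tlift_tens]. *)
Definition tlift (P : zmodType) (f : M -> N -> P) (x : tensor) : P :=
  \sum_(p <- repr x) f p.1 p.2.

Definition balanced (P : zmodType) (f : M -> N -> P) : Prop :=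
  [/\ forall m m' n, f (m + m') n = f m n + f m' n,
      forall m n n', f m (n + n') = f m n + f m n' &
      forall m b n, f (ract m b) n = f m (lact b n)].

Lemma tensDl m m' n : tens (m + m') n = tens m n + tens m' n.
Proof.
by rewrite [RHS]tensor_addE; apply: tensor_eqP (tensor_Dl _ _ _).
Qed.

Lemma tensDr m n n' : tens m (n + n') = tens m n + tens m n'.
Proof. by rewrite [RHS]tensor_addE; apply: tensor_eqP (tensor_Dr _ _ _). Qed.

Lemma tens_bal m b n : tens (ract m b) n = tens m (lact b n).
Proof. exact: tensor_eqP (tensor_bal _ _ _). Qed.

Lemma tens_sum_pi (r : seq (M * N)) : \pi_tensor r = \sum_(p <- r) tens p.1 p.2.
Proof.
elim: r => [|[m n] r IH]; first by rewrite big_nil.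
by rewrite big_cons -IH [RHS]tensor_addE.
Qed.

Lemma tensorE (x : tensor) : x = \sum_(p <- repr x) tens p.1 p.2.
Proof. by rewrite -tens_sum_pi reprK. Qed.

Section Lift.
Variables (P : zmodType) (f : M -> N -> P).
Hypothesis bf : balanced f.

Lemma tlift_pi (r : seq (M * N)) : tlift f (\pi_tensor r) = \sum_(p <- r) f p.1 p.2.
Proof.
have [fDl fDr fb] := bf.
rewrite /tlift; have := tensor_reprP r; move: (repr _) => x xr.
elim: xr => //= {x r}.
- by move=> x y z _ -> _ ->.
- by move=> x x' y y' _ e _ e'; rewrite !big_cat /= e e'.
- by move=> x y; rewrite !big_cat /= addrC.
- move=> n; rewrite big_seq1 big_nil /=.
  by apply: (addrI (f 0 n)); rewrite -fDl !addr0.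
- by move=> m m' n; rewrite big_seq1 big_cons big_seq1 /= fDl.
- by move=> m n n'; rewrite big_seq1 big_cons big_seq1 /= fDr.
- by move=> m b n; rewrite !big_seq1 /= fb.
Qed.

Lemma tlift_tens m n : tlift f (tens m n) = f m n.
Proof. by rewrite tlift_pi big_seq1. Qed.

Lemma tliftD : {morph tlift f : x y / x + y}.
Proof.
move=> x y; have -> : x + y = \pi_tensor (repr x ++ repr y) by [].
by rewrite tlift_pi big_cat.
Qed.

End Lift.

Lemma eq_tlift (P : zmodType) (f g : M -> N -> P) x :
  (forall m n, f m n = g m n) -> tlift f x = tlift g x.
Proof. by move=> fg; apply: eq_bigr. Qed.

Lemma tlift_comp (P Q : zmodType) (f : M -> N -> P) (g : P -> Q) x :
  {morph g : x y / x + y} -> g (tlift f x) = tlift (fun m n => g (f m n)) x.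
Proof.
move=> gD; rewrite /tlift; apply: (big_morph g gD).
by apply: (addrI (g 0)); rewrite -gD !addr0.
Qed.

Lemma tensor_ind_eq (P : zmodType) (g h : tensor -> P) :
  {morph g : x y / x + y} -> {morph h : x y / x + y} ->
  (forall m n, g (tens m n) = h (tens m n)) -> forall x, g x = h x.
Proof.
move=> gD hD gh x; rewrite (tensorE x).
have z (f : tensor -> P) : {morph f : x y / x + y} -> f 0 = 0.
  by move=> fD; apply: (addrI (f 0)); rewrite -fD !addr0.
by rewrite (big_morph g gD (z _ gD)) (big_morph h hD (z _ hD)); apply: eq_bigr.
Qed.

End Tensor.

Arguments tens {M N B ract lact} m n.
Arguments tlift {M N B ract lact P} f x.
Arguments tlift_comp {M N B ract lact P Q f g x}.
Arguments balanced {M N B} ract lact {P} f.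
Notation "m ⊗ n" := (tens m n) (at level 40, left associativity) : ring_scope.

Definition tmap (M N : zmodType) (B : Type) (r : M -> B -> M) (l : B -> N -> N)
    (M' N' : zmodType) (B' : Type) (r' : M' -> B' -> M') (l' : B' -> N' -> N')
    (f : M -> M') (g : N -> N') : tensor r l -> tensor r' l' :=
  tlift (fun m n => f m ⊗ g n).
Arguments tmap {M N B r l M' N' B' r' l'} f g x.

Definition is_algmap (k : comPzRingType) (V W : algType k) (f : V -> W) : Prop :=
  linear f /\ monoid_morphism f.

(* An [A^e]-ring structure on [U], given by [s a = eta (a ⊗ 1)] and
   [t a = eta (1 ⊗ a)]. *)
Record is_Ae_ring (k : comPzRingType) (A U : algType k) (s t : A -> U) : Prop := {
  Ae_src : is_algmap s;
  Ae_tgt : is_algmap (t : A^c -> U);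
  Ae_comm : forall a b, s a * t b = t b * s a }.

Section LeftBialgebroidAxioms.
Variables (k : comPzRingType) (A U : algType k) (s t : A -> U).

Definition lact_src (a : A) (u : U) : U := s a * u.
Definition ract_tgt (u : U) (a : A) : U := t a * u.

Definition TensA := tensor ract_tgt lact_src.
HB.instance Definition _ := GRing.Zmodule.on TensA.

Definition TensA_lact (a : A) : TensA -> TensA := tmap (fun u => s a * u) id.
Definition TensA_ract (x : TensA) (a : A) : TensA := tmap id (fun u => t a * u) x.

Definition tassoc : tensor TensA_ract lact_src -> tensor ract_tgt TensA_lact :=
  tlift (fun (x : TensA) w => tmap id (fun v => v ⊗ w) x).

Definition in_takeuchi (x : TensA) : Prop := forall a,
  tmap (fun u => u * t a) id x = tmap id (fun u => u * s a) x :> TensA.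

(* Factorwise product; the function being lifted is balanced when [x] is in the
   Takeuchi product. *)
Definition TensA_mul (x y : TensA) : TensA :=
  tlift (fun v v' => tmap (fun u => u * v) (fun u' => u' * v') x : TensA) y.

(* [Delta] and [eps] are [k]-linear because [c *: u = s (c *: 1) * u]. *)
Record is_left_bialgebroid (Delta : U -> TensA) (eps : U -> A) : Prop := {
  lb_Ae_ring : is_Ae_ring s t;
  lb_copD : {morph Delta : u v / u + v};
  lb_cop_src : forall a u, Delta (s a * u) = TensA_lact a (Delta u);
  lb_cop_tgt : forall a u, Delta (t a * u) = TensA_ract (Delta u) a;
  lb_epsD : {morph eps : u v / u + v};
  lb_eps_src : forall a u, eps (s a * u) = a * eps u;
  lb_eps_tgt : forall a u, eps (t a * u) = eps u * a;
  lb_coassoc : forall u,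
    tassoc (tmap Delta id (Delta u)) = tmap id Delta (Delta u);
  lb_counitl : forall u, tlift (fun u1 u2 => s (eps u1) * u2) (Delta u) = u;
  lb_counitr : forall u, tlift (fun u1 u2 => t (eps u2) * u1) (Delta u) = u;
  lb_takeuchi : forall u, in_takeuchi (Delta u);
  lb_cop1 : Delta 1 = 1 ⊗ 1;
  lb_copM : forall u v, Delta (u * v) = TensA_mul (Delta u) (Delta v);
  lb_eps1 : eps 1 = 1;
  lb_epsM_src : forall u v, eps (u * v) = eps (u * s (eps v));
  lb_epsM_tgt : forall u v, eps (u * v) = eps (u * t (eps v)) }.

End LeftBialgebroidAxioms.

Record leftBialgebroid (k : comPzRingType) (A : algType k) := LeftBialgebroid {
  lb_sort :> algType k;
  srcl : A -> lb_sort;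
  tgtl : A -> lb_sort;
  copl : lb_sort -> TensA srcl tgtl;
  epsl : lb_sort -> A;
  lbP : is_left_bialgebroid copl epsl }.

(* A left bialgebroid on the opposite algebra, with source [tgtr] and target
   [srcr]; unfolding the product of [rb_sort^c], the coproduct takes values in the
   tensor product in which [v * srcr b ⊗ v' = v ⊗ v' * tgtr b]. *)
Record rightBialgebroid (k : comPzRingType) (B : algType k) := RightBialgebroid {
  rb_sort :> algType k;
  srcr : B -> rb_sort;
  tgtr : B -> rb_sort;
  copr : rb_sort -> tensor (fun v b => v * srcr b) (fun b v => v * tgtr b);
  epsr : rb_sort -> B;
  rbP : @is_left_bialgebroid k B rb_sort^c tgtr srcr copr epsr }.

Section TensorTheory.
Variables (M N : zmodType) (B : Type) (r : M -> B -> M) (l : B -> N -> N).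

Lemma morph_add0 (P Q : zmodType) (f : P -> Q) : {morph f : x y / x + y} -> f 0 = 0.
Proof. by move=> fD; apply: (addrI (f 0)); rewrite -fD !addr0. Qed.

Lemma morph_addN (P Q : zmodType) (f : P -> Q) :
  {morph f : x y / x + y} -> {morph f : x / - x}.
Proof.
by move=> fD x; apply: (addrI (f x)); rewrite -fD !subrr (morph_add0 fD).
Qed.

Lemma morph_add_sum (P Q : zmodType) (f : P -> Q) :
  {morph f : x y / x + y} -> forall I (r : seq I) (F : I -> P),
  f (\sum_(i <- r) F i) = \sum_(i <- r) f (F i).
Proof. by move=> fD I s F; rewrite (big_morph f fD (morph_add0 fD)). Qed.

Lemma tlift_tmap (M' N' : zmodType) (B' : Type) (r' : M' -> B' -> M')
    (l' : B' -> N' -> N') (P : zmodType) (f : M' -> N' -> P) g h (x : tensor r l) :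
  balanced r' l' f ->
  tlift f (tmap g h x : tensor r' l') = tlift (fun m n => f (g m) (h n)) x.
Proof.
move=> bf; rewrite (tlift_comp (tliftD bf)).
by apply: eq_tlift => m n; rewrite tlift_tens.
Qed.

Lemma tmap_balanced (M' N' : zmodType) (B' : Type) (r' : M' -> B' -> M')
    (l' : B' -> N' -> N') g h :
  {morph g : x y / x + y} -> {morph h : x y / x + y} ->
  (forall m b n, (g (r m b) ⊗ h n : tensor r' l') = g m ⊗ h (l b n)) ->
  balanced r l (fun m n => g m ⊗ h n : tensor r' l').
Proof.
by move=> gD hD gh; split=> *; rewrite ?gD ?hD ?tensDl ?tensDr.
Qed.

Lemma tmap_tens (M' N' : zmodType) (B' : Type) (r' : M' -> B' -> M')
    (l' : B' -> N' -> N') g h m n :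
  {morph g : x y / x + y} -> {morph h : x y / x + y} ->
  (forall m b n, (g (r m b) ⊗ h n : tensor r' l') = g m ⊗ h (l b n)) ->
  tmap g h (m ⊗ n : tensor r l) = g m ⊗ h n :> tensor r' l'.
Proof. by move=> gD hD gh; rewrite /tmap tlift_tens //; apply: tmap_balanced. Qed.

Lemma tmapD (M' N' : zmodType) (B' : Type) (r' : M' -> B' -> M')
    (l' : B' -> N' -> N') g h :
  {morph g : x y / x + y} -> {morph h : x y / x + y} ->
  (forall m b n, (g (r m b) ⊗ h n : tensor r' l') = g m ⊗ h (l b n)) ->
  {morph tmap g h : x y / x + y : tensor r l >-> x + y : tensor r' l'}.
Proof. by move=> gD hD gh; apply: tliftD; apply: tmap_balanced. Qed.

End TensorTheory.

Section LeftBialgebroidTheory.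
Variables (k : comPzRingType) (A : algType k) (U : leftBialgebroid A).
Implicit Types (a b : A) (u v w : U).
Local Notation s := (srcl U).
Local Notation t := (tgtl U).
Local Notation Delta := (@copl k A U).
Local Notation eps := (@epsl k A U).

Lemma srclD : {morph s : a b / a + b}.
Proof.
case: (Ae_src (lb_Ae_ring (lbP U))) => sl _ a b.
by have := sl 1 a b; rewrite !scale1r.
Qed.
Lemma srclM : {morph s : a b / a * b}.
Proof. by case: (Ae_src (lb_Ae_ring (lbP U))) => _ []. Qed.
Lemma srcl1 : s 1 = 1.
Proof. by case: (Ae_src (lb_Ae_ring (lbP U))) => _ []. Qed.
Lemma srclZ c : {morph s : a / c *: a}.
Proof.
move=> a; case: (Ae_src (lb_Ae_ring (lbP U))) => sl _.
by have := sl c a 0; rewrite addr0 (morph_add0 srclD) addr0.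
Qed.
Lemma tgtlD : {morph t : a b / a + b}.
Proof.
case: (Ae_tgt (lb_Ae_ring (lbP U))) => sl _ a b.
by have := sl 1 a b; rewrite !scale1r.
Qed.
Lemma tgtlM a b : t (a * b) = t b * t a.
Proof. by case: (Ae_tgt (lb_Ae_ring (lbP U))) => _ [_ /(_ b a)]. Qed.
Lemma tgtl1 : t 1 = 1.
Proof. by case: (Ae_tgt (lb_Ae_ring (lbP U))) => _ []. Qed.
Lemma tgtlZ c : {morph t : a / c *: a}.
Proof.
move=> a; case: (Ae_tgt (lb_Ae_ring (lbP U))) => sl _.
by have := sl c a 0; rewrite addr0 (morph_add0 tgtlD) addr0.
Qed.
Lemma src_tgtC a b : s a * t b = t b * s a.
Proof. exact: (Ae_comm (lb_Ae_ring (lbP U))). Qed.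

Lemma coplD : {morph Delta : u v / u + v}.
Proof. exact: lb_copD (lbP U). Qed.
Lemma epslD : {morph eps : u v / u + v}.
Proof. exact: lb_epsD (lbP U). Qed.
Lemma epsl_src a u : eps (s a * u) = a * eps u.
Proof. exact: lb_eps_src (lbP U) _ _. Qed.
Lemma epsl_tgt a u : eps (t a * u) = eps u * a.
Proof. exact: lb_eps_tgt (lbP U) _ _. Qed.
Lemma epsl1 : eps 1 = 1.
Proof. exact: lb_eps1 (lbP U). Qed.
Lemma epslM_src u v : eps (u * v) = eps (u * s (eps v)).
Proof. exact: lb_epsM_src (lbP U) _ _. Qed.
Lemma epslM_tgt u v : eps (u * v) = eps (u * t (eps v)).
Proof. exact: lb_epsM_tgt (lbP U) _ _. Qed.
Lemma epsl_s a : eps (s a) = a.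
Proof. by rewrite -[s a]mulr1 epsl_src epsl1 mulr1. Qed.
Lemma epsl_t a : eps (t a) = a.
Proof. by rewrite -[t a]mulr1 epsl_tgt epsl1 mul1r. Qed.

Lemma epslZ c : {morph eps : u / c *: u}.
Proof.
move=> u; rewrite -[u in LHS]mul1r scalerAl -tgtl1 -tgtlZ epsl_tgt.
by rewrite -scalerAr mulr1.
Qed.

Lemma tens_src_tgt (u v : U) a : (t a * u) ⊗ v = u ⊗ (s a * v) :> TensA s t.
Proof. exact: (@tens_bal _ _ _ (ract_tgt t) (lact_src s)). Qed.

Section Lift.
Variables (P : zmodType) (f : U -> U -> P).
Hypothesis bf : balanced (ract_tgt t) (lact_src s) f.

Lemma tlift_cop_src a u :
  tlift f (Delta (s a * u)) = tlift (fun u1 u2 => f (s a * u1) u2) (Delta u).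
Proof. by rewrite (lb_cop_src (lbP U)) tlift_tmap. Qed.

Lemma tlift_cop_tgt a u :
  tlift f (Delta (t a * u)) = tlift (fun u1 u2 => f u1 (t a * u2)) (Delta u).
Proof. by rewrite (lb_cop_tgt (lbP U)) /TensA_ract tlift_tmap. Qed.

Lemma tlift_takeuchi a u :
  tlift (fun u1 u2 => f (u1 * t a) u2) (Delta u) =
  tlift (fun u1 u2 => f u1 (u2 * s a)) (Delta u).
Proof.
have := lb_takeuchi (lbP U) u a => /(congr1 (tlift f)).
by rewrite (tlift_tmap _ _ _ bf) (tlift_tmap _ _ _ bf).
Qed.

Lemma tlift_copM u v : tlift f (Delta (u * v)) =
  tlift (fun v1 v2 => tlift (fun u1 u2 => f (u1 * v1) (u2 * v2)) (Delta u)) (Delta v).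
Proof.
rewrite (lb_copM (lbP U)) /TensA_mul (tlift_comp (tliftD bf)).
by apply: eq_tlift => m n; rewrite tlift_tmap.
Qed.

Lemma balanced_copM u :
  balanced (ract_tgt t) (lact_src s)
    (fun v1 v2 => tlift (fun u1 u2 => f (u1 * v1) (u2 * v2)) (Delta u)).
Proof.
have [fDl fDr fb] := bf; split=> [m m' n|m n n'|m b n].
- by rewrite /tlift -big_split; apply: eq_bigr => p _; rewrite mulrDr fDl.
- by rewrite /tlift -big_split; apply: eq_bigr => p _; rewrite mulrDr fDr.
pose g u1 u2 := f (u1 * m) (u2 * n).
have bg : balanced (ract_tgt t) (lact_src s) g.
  split=> *; rewrite /g ?mulrDl ?fDl ?fDr // /ract_tgt /lact_src -!mulrA.
  exact: fb.
transitivity (tlift (fun u1 u2 => g (u1 * t b) u2) (Delta u)).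
  by apply: eq_tlift => *; rewrite /g /ract_tgt mulrA.
transitivity (tlift (fun u1 u2 => g u1 (u2 * s b)) (Delta u)); last first.
  by apply: eq_tlift => *; rewrite /g /lact_src mulrA.
have := lb_takeuchi (lbP U) u b => /(congr1 (tlift g)).
by rewrite (tlift_tmap _ _ _ bg) (tlift_tmap _ _ _ bg).
Qed.

Lemma tlift_cop1 : tlift f (Delta 1) = f 1 1.
Proof. by rewrite (lb_cop1 (lbP U)) tlift_tens. Qed.

Lemma tlift_cop_mulsrc a u :
  tlift f (Delta (u * s a)) = tlift (fun u1 u2 => f (u1 * s a) u2) (Delta u).
Proof.
rewrite tlift_copM.
rewrite -[s a]mulr1 (lb_cop_src (lbP U)) tlift_tmap; last exact: balanced_copM.
rewrite (lb_cop1 (lbP U)) tlift_tens.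
  by apply: eq_tlift => *; rewrite !mulr1.
have [Dl Dr bb] := balanced_copM u; split=> [*|*|m b n]; rewrite ?mulrDr ?Dl ?Dr //.
by rewrite -bb /ract_tgt !(mulrA (t b)) !(mulrA (s a)) src_tgtC.
Qed.

Lemma tlift_cop_multgt a u :
  tlift f (Delta (u * t a)) = tlift (fun u1 u2 => f u1 (u2 * t a)) (Delta u).
Proof.
rewrite tlift_copM.
rewrite -[t a]mulr1 (lb_cop_tgt (lbP U)) tlift_tmap; last exact: balanced_copM.
rewrite (lb_cop1 (lbP U)) tlift_tens.
  by apply: eq_tlift => *; rewrite !mulr1.
have [Dl Dr bb] := balanced_copM u; split=> [*|*|m b n]; rewrite ?mulrDr ?Dl ?Dr //.
by rewrite bb /lact_src !(mulrA (s b)) !(mulrA (t a)) src_tgtC.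
Qed.

End Lift.

Lemma tlift_coassoc (P : zmodType) (f : U -> U -> U -> P) u :
  (forall w, balanced (ract_tgt t) (lact_src s) (fun x y => f x y w)) ->
  (forall x, balanced (ract_tgt t) (lact_src s) (f x)) ->
  tlift (fun u1 u2 => tlift (fun x y => f x y u2) (Delta u1)) (Delta u) =
  tlift (fun u1 u2 => tlift (fun y z => f u1 y z) (Delta u2)) (Delta u).
Proof.
move=> bl br.
have fD1 x x' y w : f (x + x') y w = f x y w + f x' y w by have [-> _ _] := bl w.
have fD2 x y y' w : f x (y + y') w = f x y w + f x y' w by have [_ -> _] := bl w.
have fD3 x y w w' : f x y (w + w') = f x y w + f x y w' by have [_ -> _] := br x.
have fb12 x y w a : f (t a * x) y w = f x (s a * y) w by have [_ _] := bl w; apply.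
have fb23 x y w a : f x (t a * y) w = f x y (s a * w) by have [_ _] := br x; apply.
pose F x (yz : TensA s t) := tlift (f x) yz.
have bF : balanced (ract_tgt t) (@TensA_lact _ _ _ s t) F.
  split=> [m m' n|m n n'|m b n]; rewrite /F.
  - by rewrite /tlift -big_split; apply: eq_bigr => p _; rewrite fD1.
  - by rewrite tliftD.
  - rewrite [RHS]tlift_tmap //; apply: eq_tlift => y z.
    exact: fb12.
have := congr1 (tlift F) (lb_coassoc (lbP U) u).
rewrite tlift_tmap // => <-.
rewrite /tassoc (tlift_comp (tliftD bF)).
set G := fun (x : TensA s t) w => _.
have GE x w : G x w = tlift (fun x y => f x y w) x.
  rewrite /G tlift_tmap //; apply: eq_tlift => m n.
  by rewrite /F tlift_tens.
rewrite tlift_tmap; first by apply: eq_tlift => x w; rewrite GE.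
split=> [m m' n|m n n'|m b n]; rewrite !GE.
- by rewrite tliftD.
- by rewrite /tlift -big_split; apply: eq_bigr => p _; rewrite fD3.
- by rewrite /TensA_ract tlift_tmap //; apply: eq_tlift => x y; rewrite fb23.
Qed.

Lemma tlift_counitl (P : zmodType) (f : U -> P) u : {morph f : u v / u + v} ->
  tlift (fun u1 u2 => f (s (eps u1) * u2)) (Delta u) = f u.
Proof. by move=> fD; rewrite -(tlift_comp fD) (lb_counitl (lbP U)). Qed.

Lemma tlift_counitr (P : zmodType) (f : U -> P) u : {morph f : u v / u + v} ->
  tlift (fun u1 u2 => f (t (eps u2) * u1)) (Delta u) = f u.
Proof. by move=> fD; rewrite -(tlift_comp fD) (lb_counitr (lbP U)). Qed.

End LeftBialgebroidTheory.

Arguments srclD {k A U}.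
Arguments tgtlD {k A U}.
Arguments coplD {k A U}.
Arguments epslD {k A U}.

Section TassocTheory.
Variables (k : comPzRingType) (A U : algType k) (s t : A -> U).
Hypothesis st : is_Ae_ring s t.
Local Notation T := (TensA s t).

Lemma TensA_lact_balanced a : balanced (ract_tgt t) (lact_src s)
  (fun u v => (s a * u) ⊗ v : T).
Proof.
apply: (@tmap_balanced _ _ _ _ _ _ _ _ _ _ ( *%R (s a)) id) => //.
  by move=> u v; rewrite mulrDr.
move=> u b v; rewrite /ract_tgt mulrA (Ae_comm st) -mulrA.
exact: (@tens_bal _ _ _ (ract_tgt t) (lact_src s)).
Qed.

Lemma TensA_ract_balanced a : balanced (ract_tgt t) (lact_src s)
  (fun u v => u ⊗ (t a * v) : T).
Proof.
apply: (@tmap_balanced _ _ _ _ _ _ _ _ _ _ id ( *%R (t a))) => //.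
  by move=> u v; rewrite mulrDr.
move=> u b v; rewrite (@tens_bal _ _ _ (ract_tgt t) (lact_src s)) /lact_src.
by rewrite !mulrA (Ae_comm st).
Qed.

Lemma TensA_lactD a : {morph @TensA_lact _ _ _ s t a : x y / x + y}.
Proof. exact: tliftD (TensA_lact_balanced a). Qed.

Lemma TensA_ractD a : {morph (fun x : T => TensA_ract x a) : x y / x + y}.
Proof. exact: tliftD (TensA_ract_balanced a). Qed.

Lemma TensA_lact_tens a u v : TensA_lact a (u ⊗ v : T) = (s a * u) ⊗ v.
Proof. exact: tlift_tens (TensA_lact_balanced a) _ _. Qed.

Lemma TensA_ract_tens a u v : TensA_ract (u ⊗ v : T) a = u ⊗ (t a * v).
Proof. exact: tlift_tens (TensA_ract_balanced a) _ _. Qed.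

Local Notation T3 := (tensor (ract_tgt t) (@TensA_lact _ _ _ s t)).

Lemma tassoc_balanced1 w : balanced (ract_tgt t) (lact_src s)
  (fun u v => u ⊗ (v ⊗ w : T) : T3).
Proof.
apply: (@tmap_balanced _ _ _ _ _ _ _ _ _ _ id (fun v => v ⊗ w : T)) => //.
  by move=> u v; rewrite tensDl.
move=> u b v; rewrite (@tens_bal _ _ _ (ract_tgt t) (@TensA_lact _ _ _ s t)).
by rewrite TensA_lact_tens.
Qed.

Lemma tassoc_balanced : balanced (@TensA_ract _ _ _ s t) (lact_src s)
  (fun (x : T) w => tmap id (fun v => v ⊗ w : T) x : T3).
Proof.
split=> [x y w|x w w'|x b w].
- exact: tliftD (tassoc_balanced1 w) _ _.
- rewrite /tmap /tlift -big_split; apply: eq_bigr => p _.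
  by rewrite tensDr tensDr.
- rewrite /tmap tlift_tmap; last exact: tassoc_balanced1.
  apply: eq_tlift => u v; congr (_ ⊗ _).
  exact: (@tens_bal _ _ _ (ract_tgt t) (lact_src s)).
Qed.

Lemma tassocD : {morph @tassoc _ _ _ s t : x y / x + y}.
Proof. exact: tliftD tassoc_balanced. Qed.

Lemma tassoc_tens u v w : tassoc ((u ⊗ v : T) ⊗ w) = u ⊗ (v ⊗ w : T) :> T3.
Proof.
by rewrite /tassoc (tlift_tens tassoc_balanced) /tmap (tlift_tens (tassoc_balanced1 w)).
Qed.

Lemma tassoc_surj (x : T3) : exists y, tassoc y = x.
Proof.
exists (tlift (fun u vw => tlift (fun v w => (u ⊗ v : T) ⊗ w) vw) x).
rewrite (tlift_comp tassocD) [RHS]tensorE; apply: eq_bigr => p _.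
rewrite (tlift_comp tassocD).
under [LHS]eq_bigr => q _ do rewrite tassoc_tens.
rewrite [p.2 in RHS]tensorE.
by rewrite (morph_add_sum (f := fun y : T => p.1 ⊗ y : T3)) //; exact: tensDr.
Qed.

End TassocTheory.

Section FiniteProjective.
Variables (R : pzRingType) (M : lmodType R).

Definition finitely_generated : Prop := exists (n : nat) (e : 'I_n -> M),
  forall m, exists c : 'I_n -> R, m = \sum_i c i *: e i.

Definition projective : Prop :=
  forall (P Q : lmodType R) (g : {linear P -> Q}) (f : {linear M -> Q}),
  (forall q, exists p, g p = q) ->
  exists h : {linear M -> P}, forall m, g (h m) = f m.

Definition fg_projective : Prop := finitely_generated /\ projective.

Definition lincomb n (e : 'I_n -> M) (c : 'rV[R]_n) : M := \sum_i c 0 i *: e i.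

Lemma lincomb_linear n (e : 'I_n -> M) : linear (lincomb e).
Proof.
move=> a c d; rewrite /lincomb scaler_sumr -big_split; apply: eq_bigr => i _.
by rewrite !mxE scalerDl scalerA.
Qed.

HB.instance Definition _ n (e : 'I_n -> M) :=
  GRing.isLinear.Build R 'rV[R]_n M *:%R (lincomb e) (lincomb_linear e).

Lemma dual_basis : finitely_generated -> projective ->
  exists (n : nat) (e : 'I_n -> M) (f : 'I_n -> M -> R),
  [/\ forall i, {morph f i : u v / u + v}, forall i a m, f i (a *: m) = a * f i m &
      forall m, m = \sum_i f i m *: e i].
Proof.
move=> [n [e eP]] proj.
have [|h hP] := proj _ _ (lincomb e : {linear _ -> _}) (idfun : {linear M -> M}).
  move=> m; have [c ->] := eP m; exists (\row_i c i).
  by apply: eq_bigr => i _; rewrite mxE.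
exists n, e, (fun i m => h m 0 i); split=> [i u v|i a m|m].
- by rewrite raddfD mxE.
- by rewrite linearZ mxE.
- by rewrite -[LHS]hP.
Qed.

End FiniteProjective.

Section BaseModules.
Variables (k : comPzRingType) (A : algType k) (U : leftBialgebroid A).

(* [U] as a left [A]-module via [s a * u], respectively as a right [A]-module,
   i.e. a left [A^c]-module, via [t a * u]. *)
Definition srcmod : Type := U.
Definition tgtmod : Type := U.

HB.instance Definition _ := GRing.Zmodule.on srcmod.
HB.instance Definition _ := GRing.Zmodule.on tgtmod.

Definition srcmod_scale (a : A) (u : srcmod) : srcmod := srcl U a * (u : U).
Definition tgtmod_scale (a : A^c) (u : tgtmod) : tgtmod := tgtl U a * (u : U).

Lemma srcmod_scaleA a b u : srcmod_scale a (srcmod_scale b u) = srcmod_scale (a * b) u.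
Proof. by rewrite /srcmod_scale srclM mulrA. Qed.
Lemma srcmod_scale1 : left_id 1 srcmod_scale.
Proof. by move=> u; rewrite /srcmod_scale srcl1 mul1r. Qed.
Lemma srcmod_scaleDr : right_distributive srcmod_scale +%R.
Proof. by move=> a u v; rewrite /srcmod_scale [LHS]mulrDr. Qed.
Lemma srcmod_scaleDl v : {morph srcmod_scale^~ v : a b / a + b}.
Proof. by move=> a b; rewrite /srcmod_scale srclD [LHS]mulrDl. Qed.
HB.instance Definition _ := GRing.Zmodule_isLmodule.Build A srcmod
  srcmod_scaleA srcmod_scale1 srcmod_scaleDr srcmod_scaleDl.

Lemma tgtmod_scaleA a b u : tgtmod_scale a (tgtmod_scale b u) = tgtmod_scale (a * b) u.
Proof. by rewrite /tgtmod_scale mulrA -tgtlM. Qed.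
Lemma tgtmod_scale1 : left_id 1 tgtmod_scale.
Proof. by move=> u; rewrite /tgtmod_scale tgtl1 mul1r. Qed.
Lemma tgtmod_scaleDr : right_distributive tgtmod_scale +%R.
Proof. by move=> a u v; rewrite /tgtmod_scale [LHS]mulrDr. Qed.
Lemma tgtmod_scaleDl v : {morph tgtmod_scale^~ v : a b / a + b}.
Proof. by move=> a b; rewrite /tgtmod_scale tgtlD [LHS]mulrDl. Qed.
HB.instance Definition _ := GRing.Zmodule_isLmodule.Build A^c tgtmod
  tgtmod_scaleA tgtmod_scale1 tgtmod_scaleDr tgtmod_scaleDl.

End BaseModules.

Section RightDual.
Variables (k : comPzRingType) (A : algType k) (U : leftBialgebroid A).
Local Notation s := (srcl U).
Local Notation t := (tgtl U).
Local Notation Delta := (@copl k A U).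
Local Notation eps := (@epsl k A U).

(* Right [A]-linear maps from [U], with [u * a := t a * u], to [A]. *)
Definition rdual_pred : {pred U -> A} := fun phi =>
  `[< {morph phi : u v / u + v} /\ forall a u, phi (t a * u) = phi u * a >].

Record rdual := RDual { rdual_fun :> U -> A; _ : rdual_fun \in rdual_pred }.

HB.instance Definition _ := [isSub for rdual_fun].
HB.instance Definition _ := [Choice of rdual by <:].

Lemma rdual_submod_closed : submod_closed rdual_pred.
Proof.
split=> [|c f g /asboolP[fD ft] /asboolP[gD gt]]; apply/asboolP.
  by split=> [u v|a u]; [exact: esym (addr0 0) | exact: esym (mul0r a)].
split=> [u v|a u]; rewrite !addrfctE !scalrfctE.
  by rewrite fD gD scalerDr addrACA.
by rewrite ft gt mulrDl scalerAl.
Qed.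

HB.instance Definition _ :=
  GRing.isSubmodClosed.Build k (U -> A) rdual_pred rdual_submod_closed.
HB.instance Definition _ := [SubChoice_isSubLmodule of rdual by <:].

Implicit Types phi psi : rdual.

Lemma rdualD phi : {morph phi : u v / u + v}.
Proof. by case: phi => f /= /asboolP[]. Qed.

Lemma rdual_tgt_lin phi a u : phi (t a * u) = phi u * a.
Proof. by case: phi => f /= /asboolP[]. Qed.

Lemma rdualZ phi c : {morph phi : u / c *: u}.
Proof.
move=> u; rewrite -[u in LHS]mul1r scalerAl -tgtl1 -tgtlZ rdual_tgt_lin.
by rewrite -scalerAr mulr1.
Qed.

Lemma rdualP phi psi : (forall u, phi u = psi u) -> phi = psi.
Proof. by move=> e; apply: val_inj; apply: funext. Qed.

Lemma rdual_addE phi psi u : (phi + psi) u = phi u + psi u.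
Proof. by []. Qed.

Lemma rdual_scaleE c phi u : (c *: phi) u = c *: phi u.
Proof. by []. Qed.

Definition rdual_mul_fun phi psi (u : U) : A :=
  tlift (fun u1 u2 => psi (s (phi u1) * u2)) (Delta u).

Lemma rdual_mul_balanced phi psi :
  balanced (ract_tgt t) (lact_src s) (fun u1 u2 => psi (s (phi u1) * u2)).
Proof.
split=> *; rewrite ?rdualD ?srclD ?mulrDl ?mulrDr ?rdualD //.
by rewrite /ract_tgt /lact_src rdual_tgt_lin srclM mulrA.
Qed.

Lemma rdual_mul_subproof phi psi : rdual_mul_fun phi psi \in rdual_pred.
Proof.
have bm := rdual_mul_balanced phi psi.
apply/asboolP; split=> [u v|a u]; rewrite /rdual_mul_fun.
  by rewrite coplD tliftD.
rewrite tlift_cop_tgt // (@tlift_comp _ _ _ _ _ _ _ _ ( *%R^~ a)).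
  by apply: eq_tlift => u1 u2; rewrite mulrA src_tgtC -mulrA rdual_tgt_lin.
by move=> x y; rewrite mulrDl.
Qed.

Definition rdual_mul phi psi : rdual := RDual (rdual_mul_subproof phi psi).

Lemma epsl_rdual : (eps : U -> A) \in rdual_pred.
Proof. by apply/asboolP; split; [exact: epslD | exact: epsl_tgt]. Qed.

Definition rdual_one : rdual := RDual epsl_rdual.

Lemma rdual_mulA : associative rdual_mul.
Proof.
move=> f g h; apply: rdualP => u /=; rewrite /rdual_mul_fun.
transitivity (tlift (fun u1 u2 => tlift (fun x y => h (s (g (s (f u1) * x)) * y))
    (Delta u2)) (Delta u)).
  apply: eq_tlift => u1 u2; rewrite /= /rdual_mul_fun tlift_cop_src //.
  exact: rdual_mul_balanced.
rewrite -tlift_coassoc.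
- apply: eq_tlift => u1 u2; rewrite /= /rdual_mul_fun.
  by rewrite (tlift_comp srclD) /= /tlift mulr_suml (morph_add_sum (@rdualD h)).
- split=> *; rewrite ?rdualD ?srclD ?mulrDl ?mulrDr ?rdualD ?srclD ?mulrDl ?rdualD //.
  by rewrite /ract_tgt /lact_src rdual_tgt_lin srclM mulrA.
- split=> *; rewrite ?mulrDr ?rdualD ?srclD ?mulrDl ?rdualD //.
  by rewrite /ract_tgt /lact_src mulrA src_tgtC -mulrA rdual_tgt_lin srclM mulrA.
Qed.

Lemma rdual_mul1l : left_id rdual_one rdual_mul.
Proof.
by move=> f; apply: rdualP => u; rewrite /= /rdual_mul_fun tlift_counitl //; exact: rdualD.
Qed.

Lemma rdual_mul1r : right_id rdual_one rdual_mul.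
Proof.
move=> f; apply: rdualP => u; rewrite /= /rdual_mul_fun -[RHS]tlift_counitr; last exact: rdualD.
by apply: eq_tlift => u1 u2; rewrite [LHS]epsl_src rdual_tgt_lin.
Qed.

Lemma rdual_mulDl : left_distributive rdual_mul +%R.
Proof.
move=> f g h; apply: rdualP => u; rewrite rdual_addE /= /rdual_mul_fun /tlift -big_split.
by apply: eq_bigr => p _; rewrite rdual_addE srclD mulrDl rdualD.
Qed.

Lemma rdual_mulDr : right_distributive rdual_mul +%R.
Proof.
move=> f g h; apply: rdualP => u; rewrite rdual_addE /= /rdual_mul_fun /tlift -big_split.
by apply: eq_bigr => p _; rewrite rdual_addE.
Qed.

Lemma rdual_one_neq0 : rdual_one != 0.
Proof.
apply/eqP => /(congr1 (fun f : rdual => f 1)); rewrite /= epsl1 => /eqP.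
by rewrite (oner_eq0 A).
Qed.

HB.instance Definition _ := GRing.Zmodule_isNzRing.Build rdual
  rdual_mulA rdual_mul1l rdual_mul1r rdual_mulDl rdual_mulDr rdual_one_neq0.

Lemma rdual_mulE phi psi u :
  (phi * psi) u = tlift (fun u1 u2 => psi (s (phi u1) * u2)) (Delta u).
Proof. by []. Qed.

Lemma rdual_oneE u : (1 : rdual) u = eps u.
Proof. by []. Qed.

Lemma rdual_scaleAl c phi psi : c *: (phi * psi) = (c *: phi) * psi.
Proof.
apply: rdualP => u; rewrite rdual_scaleE !rdual_mulE /tlift scaler_sumr.
by apply: eq_bigr => p _; rewrite rdual_scaleE srclZ -scalerAl rdualZ.
Qed.

Lemma rdual_scaleAr c phi psi : c *: (phi * psi) = phi * (c *: psi).
Proof.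
apply: rdualP => u; rewrite rdual_scaleE !rdual_mulE /tlift scaler_sumr.
by apply: eq_bigr => p _; rewrite rdual_scaleE.
Qed.

HB.instance Definition _ := GRing.LSemiModule_isLSemiAlgebra.Build k rdual rdual_scaleAl.
HB.instance Definition _ := GRing.LSemiAlgebra_isSemiAlgebra.Build k rdual rdual_scaleAr.

Lemma rdual_src_subproof (a : A) : (fun u : U => eps (u * s a)) \in rdual_pred.
Proof.
apply/asboolP; split=> [u v|b u] /=; first by rewrite mulrDl epslD.
by rewrite -mulrA epsl_tgt.
Qed.

Definition rdual_src (a : A) : rdual := RDual (rdual_src_subproof a).

Lemma rdual_tgt_subproof (a : A) : (fun u : U => a * eps u) \in rdual_pred.
Proof.
apply/asboolP; split=> [u v|b u] /=; first by rewrite epslD mulrDr.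
by rewrite epsl_tgt mulrA.
Qed.

Definition rdual_tgt (a : A) : rdual := RDual (rdual_tgt_subproof a).

Definition rdual_aug (phi : rdual) : A := phi 1.

Lemma rdual_mul_src phi b u : (phi * rdual_src b) u = phi (u * t b).
Proof.
rewrite rdual_mulE /= -[RHS](@tlift_counitr _ _ U _ (fun v => phi (v * t b))).
2: by move=> x y; rewrite mulrDl rdualD.
transitivity (tlift (fun u1 u2 => phi u1 * eps (u2 * s b)) (Delta u)).
  by apply: eq_tlift => *; rewrite -mulrA epsl_src.
rewrite -(@tlift_takeuchi _ _ _ _ (fun u1 u2 => phi u1 * eps u2)); last first.
  split=> *; rewrite ?rdualD ?epslD ?mulrDl ?mulrDr //.
  by rewrite /ract_tgt /lact_src rdual_tgt_lin epsl_src mulrA.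
by apply: eq_tlift => *; rewrite -mulrA rdual_tgt_lin.
Qed.

Lemma rdual_mul_tgt phi b u : (phi * rdual_tgt b) u = b * phi u.
Proof.
rewrite rdual_mulE /= -[phi u]tlift_counitr; last exact: rdualD.
rewrite (@tlift_comp _ _ _ _ _ _ _ _ ( *%R b)).
  by apply: eq_tlift => *; rewrite epsl_src rdual_tgt_lin.
by move=> x y; rewrite mulrDr.
Qed.

Lemma rdual_src_mul phi b u : (rdual_src b * phi) u = phi (u * s b).
Proof.
rewrite rdual_mulE /= -[RHS]tlift_counitl; last exact: rdualD.
rewrite tlift_cop_mulsrc //.
by split=> *; rewrite ?mulrDr ?epslD ?srclD ?mulrDl ?rdualD //
  /ract_tgt /lact_src epsl_tgt srclM mulrA.
Qed.

Lemma rdual_tgt_mul phi b u : (rdual_tgt b * phi) u = phi (s b * u).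
Proof.
rewrite rdual_mulE /= -[RHS]tlift_counitl; last exact: rdualD.
rewrite tlift_cop_src; first by apply: eq_tlift => *; rewrite epsl_src.
by split=> *; rewrite ?mulrDr ?epslD ?srclD ?mulrDl ?rdualD //
  /ract_tgt /lact_src epsl_tgt srclM mulrA.
Qed.

Lemma rdual_src_algmap : is_algmap rdual_src.
Proof.
split; [move=> c a b|split=> [|a b]]; apply: rdualP => u.
- rewrite rdual_addE rdual_scaleE /= srclD srclZ mulrDr -scalerAr epslD.
  by rewrite epslZ.
- by rewrite /= srcl1 mulr1.
- by rewrite rdual_src_mul /= srclM mulrA.
Qed.

Lemma rdual_tgt_algmap : is_algmap (rdual_tgt : A^c -> rdual).
Proof.
split; [move=> c a b|split=> [|a b]]; apply: rdualP => u.
- by rewrite rdual_addE rdual_scaleE /= [LHS](@mulrDl A) scalerAl.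
- exact: (@mul1r A).
- by rewrite rdual_mul_tgt /=; exact: esym (@mulrA A _ _ _).
Qed.

Lemma rdual_Ae_ring : is_Ae_ring rdual_src rdual_tgt.
Proof.
split; [exact: rdual_src_algmap|exact: rdual_tgt_algmap|move=> a b].
by apply: rdualP => u; rewrite rdual_mul_tgt rdual_tgt_mul /= -mulrA epsl_src.
Qed.

Definition RDTens :=
  tensor (fun (v : rdual) b => v * rdual_src b) (fun b (v : rdual) => v * rdual_tgt b).
HB.instance Definition _ := GRing.Zmodule.on RDTens.

(* The pairing [phi1 ⊗ phi2 |-> phi1 (u * t (phi2 u'))], through which the
   coproduct is characterized; when [tgtmod U] is finitely generated projective
   the coproduct exists ([rdual_copP]) and is unique ([rdual_cop_unique]). *)
Definition rdual_eval (X : RDTens) (u u' : U) : A :=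
  tlift (fun phi1 phi2 => phi1 (u * t (phi2 u'))) X.

Definition rdual_cop (phi : rdual) : RDTens :=
  xget 0 [set X | forall u u', phi (u * u') = rdual_eval X u u'].

Lemma rdual_eval_balanced u u' :
  balanced (fun (v : rdual) b => v * rdual_src b) (fun b (v : rdual) => v * rdual_tgt b)
    (fun phi1 phi2 => phi1 (u * t (phi2 u'))).
Proof.
split=> [f f' g|f g g'|f b g]; rewrite ?rdual_addE //.
  by rewrite tgtlD mulrDr rdualD.
by rewrite rdual_mul_src rdual_mul_tgt tgtlM mulrA.
Qed.
#[local] Hint Resolve rdual_eval_balanced : core.

Lemma rdual_eval_tens (f g : rdual) u u' :
  rdual_eval (f ⊗ g) u u' = f (u * t (g u')).
Proof. by rewrite /rdual_eval tlift_tens. Qed.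

Lemma rdual_evalD X Y u u' :
  rdual_eval (X + Y) u u' = rdual_eval X u u' + rdual_eval Y u u'.
Proof. exact: tliftD. Qed.

Section DualBasis.
Variables (n : nat) (e : 'I_n -> U) (f : 'I_n -> rdual).
Hypothesis ef : forall u, u = \sum_i t (f i u) * e i.

Lemma rdual_tensE (M : zmodType) (rM : M -> A -> M) :
  (forall a, {morph rM^~ a : x y / x + y}) -> (forall m, {morph rM m : x y / x + y}) ->
  (forall m a b, rM (rM m a) b = rM m (a * b)) ->
  forall X : tensor rM (fun b (v : rdual) => v * rdual_tgt b),
  X = \sum_i tlift (fun m phi => rM m (phi (e i))) X ⊗ f i.
Proof.
move=> rDl rDr rA.
have bal i : balanced rM (fun b (v : rdual) => v * rdual_tgt b)
    (fun m phi => rM m (phi (e i))).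
  by split=> *; rewrite ?rDl ?rDr // rA rdual_mul_tgt.
apply: (@tensor_ind_eq _ _ _ _ _ _ id) => [//|X Y|m phi].
  by rewrite -big_split; apply: eq_bigr => i _; rewrite tliftD // tensDl.
transitivity (\sum_i m ⊗ (f i * rdual_tgt (phi (e i)))
    : tensor rM (fun b (v : rdual) => v * rdual_tgt b)); last first.
  apply: eq_bigr => i _; rewrite tlift_tens //.
  by rewrite -(@tens_bal _ _ _ rM (fun b (v : rdual) => v * rdual_tgt b)).
rewrite -(morph_add_sum (f := fun x => m ⊗ x
   : tensor rM (fun b (v : rdual) => v * rdual_tgt b))); last exact: tensDr.
congr tens; apply: rdualP => u.
rewrite (morph_add_sum (f := fun x : rdual => x u)) //.
rewrite {1}(ef u) (morph_add_sum (@rdualD phi)).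
by apply: eq_bigr => i _; rewrite rdual_tgt_lin rdual_mul_tgt.
Qed.

Lemma rdual_tens_inj (X Y : RDTens) :
  (forall u u', rdual_eval X u u' = rdual_eval Y u u') -> X = Y.
Proof.
move=> XY.
have aD a : {morph (fun v : rdual => v * rdual_src a) : x y / x + y}.
  by move=> x y; rewrite mulrDl.
have mD (m : rdual) : {morph (fun a => m * rdual_src a) : x y / x + y}.
  move=> x y; rewrite -mulrDr; congr (_ * _).
  by apply: rdualP => u; rewrite rdual_addE /= srclD mulrDr epslD.
have mA (m : rdual) a b : m * rdual_src a * rdual_src b = m * rdual_src (a * b).
  by rewrite -mulrA; case: rdual_src_algmap => _ [_ ->].
rewrite (rdual_tensE aD mD mA X) (rdual_tensE aD mD mA Y).
apply: eq_bigr => i _; congr tens; apply: rdualP => u.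
have E (Z : RDTens) : (tlift (fun m phi : rdual => m * rdual_src (phi (e i))) Z : rdual) u
    = rdual_eval Z u (e i).
  rewrite (tlift_comp (g := fun x : rdual => x u)) //.
  by apply: eq_tlift => *; rewrite rdual_mul_src.
by rewrite !E.
Qed.

Lemma rdual_copP phi u u' : phi (u * u') = rdual_eval (rdual_cop phi) u u'.
Proof.
suff [X XP] : exists X : RDTens, forall u u', phi (u * u') = rdual_eval X u u'.
  by have := @xgetI _ 0 [set X | forall u u', phi (u * u') = rdual_eval X u u'] X XP; exact.
have phie i : (fun u : U => phi (u * e i)) \in rdual_pred.
  apply/asboolP; split=> [v w|a v] /=; first by rewrite mulrDl rdualD.
  by rewrite -mulrA rdual_tgt_lin.
exists (\sum_i RDual (phie i) ⊗ f i) => {}u {}u'.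
rewrite (morph_add_sum (f := fun X : RDTens => rdual_eval X u u')); last first.
  by move=> *; exact: rdual_evalD.
rewrite {1}(ef u') mulr_sumr (morph_add_sum (@rdualD phi)).
by apply: eq_bigr => i _; rewrite rdual_eval_tens /= mulrA.
Qed.

Lemma rdual_cop_unique phi (X : RDTens) :
  (forall u u', phi (u * u') = rdual_eval X u u') -> rdual_cop phi = X.
Proof. by move=> XP; apply: rdual_tens_inj => u u'; rewrite -rdual_copP -XP. Qed.

Lemma rdual_eval_tmap (g h : rdual -> rdual) (X : RDTens) u u' :
  rdual_eval (tmap g h X : RDTens) u u' =
  tlift (fun f1 f2 => g f1 (u * t (h f2 u'))) X.
Proof. exact: tlift_tmap. Qed.

Local Notation V := (rdual : algType k).
Local Notation Vc := (V^c).

Lemma rdual_copD : {morph rdual_cop : x y / x + y}.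
Proof.
move=> x y; apply: rdual_cop_unique => u u'.
by rewrite rdual_evalD -!rdual_copP.
Qed.

Lemma rdual_cop_mul_tgt phi a :
  rdual_cop (phi * rdual_tgt a) =
  tmap (fun v => v * rdual_tgt a) id (rdual_cop phi).
Proof.
apply: rdual_cop_unique => u u'; rewrite rdual_mul_tgt rdual_copP rdual_eval_tmap.
rewrite (tlift_comp (g := fun x => a * x)); last by move=> x y; rewrite mulrDr.
by apply: eq_tlift => *; rewrite rdual_mul_tgt.
Qed.

Lemma rdual_cop_mul_src phi a :
  rdual_cop (phi * rdual_src a) =
  tmap id (fun v => v * rdual_src a) (rdual_cop phi).
Proof.
apply: rdual_cop_unique => u u'; rewrite rdual_mul_src rdual_eval_tmap -mulrA rdual_copP.
by apply: eq_tlift => *; rewrite rdual_mul_src.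
Qed.

Lemma rdual_cop_takeuchi phi a :
  tmap (fun v => rdual_src a * v) id (rdual_cop phi) =
  tmap id (fun v => rdual_tgt a * v) (rdual_cop phi) :> RDTens.
Proof.
apply: rdual_tens_inj => u u'; rewrite !rdual_eval_tmap.
transitivity (phi (u * (s a * u'))).
  rewrite mulrA rdual_copP; apply: eq_tlift => *.
  by rewrite rdual_src_mul -mulrA -src_tgtC mulrA.
by rewrite rdual_copP; apply: eq_tlift => *; rewrite rdual_tgt_mul.
Qed.

Lemma rdual_cop1 : rdual_cop 1 = 1 ⊗ 1.
Proof.
by apply: rdual_cop_unique => u u'; rewrite rdual_eval_tens !rdual_oneE epslM_tgt.
Qed.

Lemma rdual_cop_counit phi :
  tlift (fun f1 f2 => f2 * rdual_tgt (rdual_aug f1)) (rdual_cop phi) = phi.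
Proof.
apply: rdualP => u; rewrite -[u in RHS]mul1r rdual_copP.
rewrite (tlift_comp (g := fun x : rdual => x u)) //.
by apply: eq_tlift => f1 f2; rewrite rdual_mul_tgt mul1r -[t _]mulr1 rdual_tgt_lin.
Qed.

Lemma rdual_cop_counit' phi :
  tlift (fun f1 f2 => f1 * rdual_src (rdual_aug f2)) (rdual_cop phi) = phi.
Proof.
apply: rdualP => u; rewrite -[u in RHS]mulr1 rdual_copP.
rewrite (tlift_comp (g := fun x : rdual => x u)) //.
by apply: eq_tlift => f1 f2; rewrite rdual_mul_src.
Qed.

Lemma rdual_cop_mul phi psi :
  rdual_cop (phi * psi) =
  tlift (fun v v' => tmap (fun u => v * u) (fun u' => v' * u') (rdual_cop psi)
    : RDTens) (rdual_cop phi).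
Proof.
apply: rdual_cop_unique => u u'.
rewrite [RHS](tlift_comp (g := fun X : RDTens => rdual_eval X u u')); last first.
  by move=> *; exact: rdual_evalD.
rewrite rdual_mulE tlift_copM; last exact: rdual_mul_balanced.
transitivity (tlift (fun v1 v2 => tlift (fun u1 u2 =>
    tlift (fun f1 f2 : rdual => psi (s (f1 (u1 * t (f2 v1))) * (u2 * v2))) (rdual_cop phi))
    (Delta u)) (Delta u')).
  apply: eq_tlift => v1 v2; apply: eq_tlift => u1 u2.
  rewrite (rdual_copP phi) -(tlift_comp (g := fun x => psi (s x * (u2 * v2)))) //.
  by move=> x y; rewrite srclD mulrDl rdualD.
transitivity (tlift (fun f1 f2 : rdual => tlift (fun v1 v2 => tlift (fun u1 u2 =>
    psi (s (f1 (u1 * t (f2 v1))) * (u2 * v2))) (Delta u)) (Delta u')) (rdual_cop phi)).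
  rewrite /tlift; under eq_bigr => p _ do rewrite exchange_big /=.
  by rewrite exchange_big.
apply: eq_tlift => f1 f2; rewrite rdual_eval_tmap.
transitivity (tlift (fun v1 v2 => tlift (fun u1 u2 => tlift (fun g1 g2 : rdual =>
    g1 (s (f1 u1) * u2 * t (g2 (s (f2 v1) * v2)))) (rdual_cop psi)) (Delta u)) (Delta u')).
  apply: eq_tlift => v1 v2.
  rewrite (@tlift_takeuchi _ _ _ _ (fun u1 u2 => psi (s (f1 u1) * (u2 * v2)))); last first.
    split=> *; rewrite ?rdualD ?srclD ?mulrDl ?mulrDr ?rdualD //.
    by rewrite /ract_tgt /lact_src rdual_tgt_lin srclM !mulrA.
  by apply: eq_tlift => u1 u2; rewrite -mulrA mulrA rdual_copP.
transitivity (tlift (fun g1 g2 : rdual => tlift (fun v1 v2 => tlift (fun u1 u2 =>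
    g1 (s (f1 u1) * u2 * t (g2 (s (f2 v1) * v2)))) (Delta u)) (Delta u')) (rdual_cop psi)).
  rewrite /tlift; under eq_bigr => p _ do rewrite exchange_big /=.
  by rewrite exchange_big.
apply: eq_tlift => g1 g2; rewrite rdual_mulE tlift_cop_multgt; last exact: rdual_mul_balanced.
rewrite [LHS]exchange_big /=; apply: eq_bigr => -[u1 u2] _ /=.
rewrite /rdual_mul_fun (tlift_comp tgtlD).
rewrite [RHS](tlift_comp (g := fun x => g1 (s (f1 u1) * (u2 * x)))).
  by apply: eq_bigr => p _; rewrite mulrA.
by move=> x y; rewrite !mulrDr rdualD.
Qed.

Lemma rdual_eval_tgt a X u u' :
  rdual_eval (tmap (fun v => v * rdual_tgt a) id X) u u' = a * rdual_eval X u u'.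
Proof.
rewrite rdual_eval_tmap (tlift_comp (g := fun x => a * x)); last first.
  by move=> x y; rewrite mulrDr.
by apply: eq_tlift => *; rewrite rdual_mul_tgt.
Qed.

Lemma rdual_eval_src a X u u' :
  rdual_eval (tmap id (fun v => v * rdual_src a) X) u u' = rdual_eval X u (u' * t a).
Proof. by rewrite rdual_eval_tmap; apply: eq_tlift => *; rewrite rdual_mul_src. Qed.

Lemma rdual_Ae_ring_op : @is_Ae_ring k A Vc rdual_tgt rdual_src.
Proof.
case: rdual_Ae_ring => -[sl [s1 sM]] [tl [t1 tM]] st; split.
- by split=> //; split=> // a b; exact: tM.
- by split=> //; split=> // a b; exact: sM.
- by move=> a b; exact: st.
Qed.

Lemma rdual_coassoc phi :
  @tassoc k A Vc rdual_tgt rdual_src (tmap rdual_cop id (rdual_cop phi)) =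
  tmap id rdual_cop (rdual_cop phi).
Proof.
have st := rdual_Ae_ring_op.
set Y := RHS; have [Y' YE] := tassoc_surj st Y; rewrite -YE.
set X := tmap _ _ _; congr tassoc.
pose rM := @TensA_ract k A Vc rdual_tgt rdual_src.
have evalr (Z : RDTens) a u u' : rdual_eval (rM Z a) u u' = rdual_eval Z u (u' * t a).
  exact: rdual_eval_src.
have rMDl a : {morph rM^~ a : x y / x + y} by exact: (TensA_ractD st).
have rMDr Z : {morph rM Z : x y / x + y}.
  move=> a b; apply: rdual_tens_inj => u u'.
  rewrite rdual_evalD !evalr /rdual_eval /tlift -big_split.
  by apply: eq_bigr => p _; rewrite tgtlD mulrDr rdualD tgtlD mulrDr rdualD.
have rMA Z a b : rM (rM Z a) b = rM Z (a * b).
  by apply: rdual_tens_inj => u u'; rewrite !evalr tgtlM mulrA.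
rewrite (rdual_tensE rMDl rMDr rMA X) (rdual_tensE rMDl rMDr rMA Y').
apply: eq_bigr => i _; congr tens; apply: rdual_tens_inj => u u'.
pose G w (Z : tensor rM (fun b (v : rdual) => v * rdual_tgt b)) :=
  tlift (fun x (h : rdual) => rdual_eval x u (u' * t (h w))) Z.
have GE w Z : rdual_eval (tlift (fun x (h : rdual) => rM x (h w)) Z) u u' = G w Z.
  rewrite (tlift_comp (g := fun z : RDTens => rdual_eval z u u')).
    by apply: eq_tlift => x h; rewrite evalr.
  by move=> *; exact: rdual_evalD.
rewrite !GE.
pose T w (z : tensor (fun (v : rdual) b => v * rdual_src b)
    (@TensA_lact k A Vc rdual_tgt rdual_src)) :=
  tlift (fun (f1 : rdual) y => f1 (u * t (rdual_eval y u' w))) z.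
have bT w : balanced (fun (v : rdual) b => v * rdual_src b)
    (@TensA_lact k A Vc rdual_tgt rdual_src)
    (fun (f1 : rdual) y => f1 (u * t (rdual_eval y u' w))).
  split=> [//|f1 x y|f1 b y].
    by rewrite rdual_evalD tgtlD mulrDr rdualD.
  by rewrite rdual_mul_src [in RHS]rdual_eval_tgt tgtlM mulrA.
have GT w Z : G w Z = T w (@tassoc k A Vc rdual_tgt rdual_src Z).
  rewrite /T /tassoc [RHS](tlift_comp (tliftD (bT w))).
  apply: eq_tlift => x h; rewrite [RHS](tlift_tmap _ _ _ (bT w)).
  by apply: eq_tlift => f1 f2; rewrite rdual_eval_tens.
have -> : G (e i) X = phi (u * (u' * e i)).
  rewrite /G tlift_tmap; last first.
    split=> [x y h|x h h'|x b h]; first exact: rdual_evalD.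
      rewrite tgtlD mulrDr /rdual_eval /tlift -big_split.
      by apply: eq_bigr => p _; rewrite rdualD tgtlD mulrDr rdualD.
    by rewrite evalr [in RHS]rdual_mul_tgt tgtlM mulrA.
  rewrite mulrA rdual_copP; apply: eq_tlift => f1 f2.
  by rewrite -rdual_copP mulrA.
rewrite GT YE.
rewrite /T /Y tlift_tmap // rdual_copP; apply: eq_tlift => f1 f2.
by rewrite -rdual_copP.
Qed.

Lemma rdual_is_bialgebroid :
  @is_left_bialgebroid k A Vc rdual_tgt rdual_src rdual_cop rdual_aug.
Proof.
split.
- exact: rdual_Ae_ring_op.
- exact: rdual_copD.
- by move=> a phi; exact: rdual_cop_mul_tgt.
- by move=> a phi; exact: rdual_cop_mul_src.
- by [].
- by move=> a phi; exact: rdual_mul_tgt.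
- move=> a phi; rewrite /rdual_aug [LHS]rdual_mul_src mul1r -[t a]mulr1.
  exact: rdual_tgt_lin.
- exact: rdual_coassoc.
- exact: rdual_cop_counit.
- exact: rdual_cop_counit'.
- by move=> phi a; exact: rdual_cop_takeuchi.
- exact: rdual_cop1.
- by move=> phi psi; exact: rdual_cop_mul.
- exact: epsl1.
- move=> phi psi; rewrite /rdual_aug [LHS]rdual_mulE [RHS]rdual_tgt_mul.
  rewrite tlift_cop1 //; exact: rdual_mul_balanced.
- move=> phi psi; rewrite /rdual_aug [LHS]rdual_mulE [RHS]rdual_src_mul mul1r.
  rewrite tlift_cop1 ?mulr1 //; exact: rdual_mul_balanced.
Qed.

End DualBasis.

Lemma rdual_bialgebroid_axioms :
  fg_projective (tgtmod U) ->
  @is_left_bialgebroid k A rdual^c rdual_tgt rdual_src rdual_cop rdual_aug.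
Proof.
move=> [fg proj]; have [n [e [f [fD fZ ef]]]] := dual_basis fg proj.
have fP i : (f i : U -> A) \in rdual_pred.
  by apply/asboolP; split; [exact: fD | move=> a u; exact: fZ].
exact: (@rdual_is_bialgebroid n e (fun i => RDual (fP i)) ef).
Qed.

End RightDual.

Section LeftDual.
Variables (k : comPzRingType) (A : algType k) (U : leftBialgebroid A).
Local Notation s := (srcl U).
Local Notation t := (tgtl U).
Local Notation Delta := (@copl k A U).
Local Notation eps := (@epsl k A U).

(* Left [A]-linear maps from [U], with [a * u := s a * u], to [A]. *)
Definition ldual_pred : {pred U -> A} := fun psi =>
  `[< {morph psi : u v / u + v} /\ forall a u, psi (s a * u) = a * psi u >].

Record ldual := LDual { ldual_fun :> U -> A; _ : ldual_fun \in ldual_pred }.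

HB.instance Definition _ := [isSub for ldual_fun].
HB.instance Definition _ := [Choice of ldual by <:].

Lemma ldual_submod_closed : submod_closed ldual_pred.
Proof.
split=> [|c f g /asboolP[fD ft] /asboolP[gD gt]]; apply/asboolP.
  by split=> [u v|a u]; [exact: esym (addr0 0) | exact: esym (mulr0 a)].
split=> [u v|a u]; rewrite !addrfctE !scalrfctE.
  by rewrite fD gD scalerDr addrACA.
by rewrite ft gt mulrDr scalerAr.
Qed.

HB.instance Definition _ :=
  GRing.isSubmodClosed.Build k (U -> A) ldual_pred ldual_submod_closed.
HB.instance Definition _ := [SubChoice_isSubLmodule of ldual by <:].

Implicit Types phi psi : ldual.

Lemma ldualD phi : {morph phi : u v / u + v}.
Proof. by case: phi => f /= /asboolP[]. Qed.

Lemma ldual_src_lin phi a u : phi (s a * u) = a * phi u.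
Proof. by case: phi => f /= /asboolP[]. Qed.

Lemma ldualZ phi c : {morph phi : u / c *: u}.
Proof.
move=> u; rewrite -[u in LHS]mul1r scalerAl -srcl1 -srclZ ldual_src_lin.
by rewrite -scalerAl mul1r.
Qed.

Lemma ldualP phi psi : (forall u, phi u = psi u) -> phi = psi.
Proof. by move=> e; apply: val_inj; apply: funext. Qed.

Lemma ldual_addE phi psi u : (phi + psi) u = phi u + psi u.
Proof. by []. Qed.

Lemma ldual_scaleE c phi u : (c *: phi) u = c *: phi u.
Proof. by []. Qed.

Definition ldual_mul_fun phi psi (u : U) : A :=
  tlift (fun u1 u2 => psi (t (phi u2) * u1)) (Delta u).

Lemma ldual_mul_balanced phi psi :
  balanced (ract_tgt t) (lact_src s) (fun u1 u2 => psi (t (phi u2) * u1)).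
Proof.
split=> *; rewrite ?ldualD ?tgtlD ?mulrDl ?mulrDr ?ldualD //.
by rewrite /ract_tgt /lact_src ldual_src_lin tgtlM mulrA.
Qed.

Lemma ldual_mul_subproof phi psi : ldual_mul_fun phi psi \in ldual_pred.
Proof.
have bm := ldual_mul_balanced phi psi.
apply/asboolP; split=> [u v|a u]; rewrite /ldual_mul_fun.
  by rewrite coplD tliftD.
rewrite tlift_cop_src // (@tlift_comp _ _ _ _ _ _ _ _ ( *%R a)).
  by apply: eq_tlift => u1 u2; rewrite mulrA -src_tgtC -mulrA ldual_src_lin.
by move=> x y; rewrite mulrDr.
Qed.

Definition ldual_mul phi psi : ldual := LDual (ldual_mul_subproof phi psi).

Lemma epsl_ldual : (eps : U -> A) \in ldual_pred.
Proof. by apply/asboolP; split; [exact: epslD | exact: epsl_src]. Qed.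

Definition ldual_one : ldual := LDual epsl_ldual.

Lemma ldual_mulA : associative ldual_mul.
Proof.
move=> f g h; apply: ldualP => u /=; rewrite /ldual_mul_fun.
transitivity (tlift (fun u1 u2 => tlift (fun x y => h (t (g (t (f u2) * y)) * x))
    (Delta u1)) (Delta u)).
  apply: eq_tlift => u1 u2; rewrite /= /ldual_mul_fun tlift_cop_tgt //.
  exact: ldual_mul_balanced.
rewrite (@tlift_coassoc _ _ _ _ (fun x y z => h (t (g (t (f z) * y)) * x))).
- apply: eq_tlift => u1 u2; rewrite /= /ldual_mul_fun.
  by rewrite (tlift_comp tgtlD) /= /tlift mulr_suml (morph_add_sum (@ldualD h)).
- split=> *; rewrite ?mulrDr ?ldualD ?tgtlD ?mulrDl ?ldualD //.
  rewrite /ract_tgt /lact_src [t _ * (s _ * _)]mulrA -src_tgtC -mulrA.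
  by rewrite ldual_src_lin tgtlM mulrA.
- split=> *; rewrite ?ldualD ?tgtlD ?mulrDl ?mulrDr ?ldualD ?tgtlD ?mulrDl ?ldualD //.
  by rewrite /ract_tgt /lact_src ldual_src_lin tgtlM mulrA.
Qed.

Lemma ldual_mul1l : left_id ldual_one ldual_mul.
Proof.
by move=> f; apply: ldualP => u; rewrite /= /ldual_mul_fun tlift_counitr //; exact: ldualD.
Qed.

Lemma ldual_mul1r : right_id ldual_one ldual_mul.
Proof.
move=> f; apply: ldualP => u; rewrite /= /ldual_mul_fun -[RHS]tlift_counitl; last exact: ldualD.
by apply: eq_tlift => u1 u2; rewrite [LHS]epsl_tgt ldual_src_lin.
Qed.

Lemma ldual_mulDl : left_distributive ldual_mul +%R.
Proof.
move=> f g h; apply: ldualP => u; rewrite ldual_addE /= /ldual_mul_fun /tlift -big_split.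
by apply: eq_bigr => p _; rewrite ldual_addE tgtlD mulrDl ldualD.
Qed.

Lemma ldual_mulDr : right_distributive ldual_mul +%R.
Proof.
move=> f g h; apply: ldualP => u; rewrite ldual_addE /= /ldual_mul_fun /tlift -big_split.
by apply: eq_bigr => p _; rewrite ldual_addE.
Qed.

Lemma ldual_one_neq0 : ldual_one != 0.
Proof.
apply/eqP => /(congr1 (fun f : ldual => f 1)); rewrite /= epsl1 => /eqP.
by rewrite (oner_eq0 A).
Qed.

HB.instance Definition _ := GRing.Zmodule_isNzRing.Build ldual
  ldual_mulA ldual_mul1l ldual_mul1r ldual_mulDl ldual_mulDr ldual_one_neq0.

Lemma ldual_mulE phi psi u :
  (phi * psi) u = tlift (fun u1 u2 => psi (t (phi u2) * u1)) (Delta u).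
Proof. by []. Qed.

Lemma ldual_oneE u : (1 : ldual) u = eps u.
Proof. by []. Qed.

Lemma ldual_scaleAl c phi psi : c *: (phi * psi) = (c *: phi) * psi.
Proof.
apply: ldualP => u; rewrite ldual_scaleE !ldual_mulE /tlift scaler_sumr.
by apply: eq_bigr => p _; rewrite ldual_scaleE tgtlZ -scalerAl ldualZ.
Qed.

Lemma ldual_scaleAr c phi psi : c *: (phi * psi) = phi * (c *: psi).
Proof.
apply: ldualP => u; rewrite ldual_scaleE !ldual_mulE /tlift scaler_sumr.
by apply: eq_bigr => p _; rewrite ldual_scaleE.
Qed.

HB.instance Definition _ := GRing.LSemiModule_isLSemiAlgebra.Build k ldual ldual_scaleAl.
HB.instance Definition _ := GRing.LSemiAlgebra_isSemiAlgebra.Build k ldual ldual_scaleAr.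

Lemma ldual_src_subproof (a : A) : (fun u : U => eps u * a) \in ldual_pred.
Proof.
apply/asboolP; split=> [u v|b u] /=; first by rewrite epslD mulrDl.
by rewrite epsl_src mulrA.
Qed.

Definition ldual_src (a : A) : ldual := LDual (ldual_src_subproof a).

Lemma ldual_tgt_subproof (a : A) : (fun u : U => eps (u * t a)) \in ldual_pred.
Proof.
apply/asboolP; split=> [u v|b u] /=; first by rewrite mulrDl epslD.
by rewrite -mulrA epsl_src.
Qed.

Definition ldual_tgt (a : A) : ldual := LDual (ldual_tgt_subproof a).

Definition ldual_aug (phi : ldual) : A := phi 1.

Lemma ldual_mul_tgt phi b u : (phi * ldual_tgt b) u = phi (u * s b).
Proof.
rewrite ldual_mulE /= -[RHS](@tlift_counitl _ _ U _ (fun v => phi (v * s b))).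
2: by move=> x y; rewrite mulrDl ldualD.
transitivity (tlift (fun u1 u2 => eps (u1 * t b) * phi u2) (Delta u)).
  by apply: eq_tlift => *; rewrite -mulrA epsl_tgt.
rewrite (@tlift_takeuchi _ _ _ _ (fun u1 u2 => eps u1 * phi u2)); last first.
  split=> *; rewrite ?ldualD ?epslD ?mulrDl ?mulrDr //.
  by rewrite /ract_tgt /lact_src ldual_src_lin epsl_tgt mulrA.
by apply: eq_tlift => *; rewrite -mulrA ldual_src_lin.
Qed.

Lemma ldual_mul_src phi b u : (phi * ldual_src b) u = phi u * b.
Proof.
rewrite ldual_mulE /= -[phi u]tlift_counitl; last exact: ldualD.
rewrite (@tlift_comp _ _ _ _ _ _ _ _ ( *%R^~ b)).
  by apply: eq_tlift => *; rewrite epsl_tgt ldual_src_lin.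
by move=> x y; rewrite mulrDl.
Qed.

Lemma ldual_tgt_mul phi b u : (ldual_tgt b * phi) u = phi (u * t b).
Proof.
rewrite ldual_mulE /= -[RHS]tlift_counitr; last exact: ldualD.
rewrite tlift_cop_multgt //.
by split=> *; rewrite ?mulrDr ?epslD ?tgtlD ?mulrDl ?ldualD //
  /ract_tgt /lact_src epsl_src tgtlM mulrA.
Qed.

Lemma ldual_src_mul phi b u : (ldual_src b * phi) u = phi (t b * u).
Proof.
rewrite ldual_mulE /= -[RHS]tlift_counitr; last exact: ldualD.
rewrite tlift_cop_tgt; first by apply: eq_tlift => *; rewrite epsl_tgt.
by split=> *; rewrite ?mulrDr ?epslD ?tgtlD ?mulrDl ?ldualD //
  /ract_tgt /lact_src epsl_src tgtlM mulrA.
Qed.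

Lemma ldual_src_algmap : is_algmap ldual_src.
Proof.
split; [move=> c a b|split=> [|a b]]; apply: ldualP => u.
- by rewrite ldual_addE ldual_scaleE /= mulrDr scalerAr.
- by rewrite /= mulr1.
- by rewrite ldual_mul_src /= mulrA.
Qed.

Lemma ldual_tgt_algmap : is_algmap (ldual_tgt : A^c -> ldual).
Proof.
split; [move=> c a b|split=> [|a b]]; apply: ldualP => u.
- rewrite ldual_addE ldual_scaleE /= [X in u * X]tgtlD tgtlZ mulrDr -scalerAr epslD.
  by rewrite epslZ.
- by rewrite /= [X in u * X]tgtl1 mulr1.
- by rewrite ldual_tgt_mul /= [X in u * X]tgtlM mulrA.
Qed.

Lemma ldual_Ae_ring : is_Ae_ring ldual_src ldual_tgt.
Proof.
split; [exact: ldual_src_algmap|exact: ldual_tgt_algmap|move=> a b].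
by apply: ldualP => u; rewrite ldual_mul_src ldual_src_mul /= -mulrA epsl_tgt.
Qed.

Definition LDTens :=
  tensor (fun (v : ldual) b => v * ldual_src b) (fun b (v : ldual) => v * ldual_tgt b).
HB.instance Definition _ := GRing.Zmodule.on LDTens.

(* Here the factors are exchanged: [psi1 ⊗ psi2 |-> psi2 (u * s (psi1 u'))]. *)
Definition ldual_eval (X : LDTens) (u u' : U) : A :=
  tlift (fun psi1 psi2 => psi2 (u * s (psi1 u'))) X.

Definition ldual_cop (psi : ldual) : LDTens :=
  xget 0 [set X | forall u u', psi (u * u') = ldual_eval X u u'].

Lemma ldual_eval_balanced u u' :
  balanced (fun (v : ldual) b => v * ldual_src b) (fun b (v : ldual) => v * ldual_tgt b)
    (fun phi1 phi2 => phi2 (u * s (phi1 u'))).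
Proof.
split=> [f f' g|f g g'|f b g]; rewrite ?ldual_addE //.
  by rewrite srclD mulrDr ldualD.
by rewrite ldual_mul_src ldual_mul_tgt srclM mulrA.
Qed.
#[local] Hint Resolve ldual_eval_balanced : core.

Lemma ldual_eval_tens (f g : ldual) u u' :
  ldual_eval (f ⊗ g) u u' = g (u * s (f u')).
Proof. by rewrite /ldual_eval tlift_tens. Qed.

Lemma ldual_evalD X Y u u' :
  ldual_eval (X + Y) u u' = ldual_eval X u u' + ldual_eval Y u u'.
Proof. exact: tliftD. Qed.

Section DualBasis.
Variables (n : nat) (e : 'I_n -> U) (f : 'I_n -> ldual).
Hypothesis ef : forall u, u = \sum_i s (f i u) * e i.

Lemma ldual_tensE (M : zmodType) (lM : A -> M -> M) :
  (forall a, {morph lM a : x y / x + y}) -> (forall m, {morph lM^~ m : x y / x + y}) ->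
  (forall m a b, lM a (lM b m) = lM (a * b) m) ->
  forall X : tensor (fun (v : ldual) b => v * ldual_src b) lM,
  X = \sum_i f i ⊗ tlift (fun phi m => lM (phi (e i)) m) X.
Proof.
move=> lDl lDr lA.
have bal i : balanced (fun (v : ldual) b => v * ldual_src b) lM
    (fun phi m => lM (phi (e i)) m).
  by split=> *; rewrite ?lDr ?lDl // lA ldual_mul_src.
apply: (@tensor_ind_eq _ _ _ _ _ _ id) => [//|X Y|phi m].
  by rewrite -big_split; apply: eq_bigr => i _; rewrite tliftD // tensDr.
transitivity (\sum_i (f i * ldual_src (phi (e i))) ⊗ m
    : tensor (fun (v : ldual) b => v * ldual_src b) lM); last first.
  apply: eq_bigr => i _; rewrite tlift_tens //.
  exact: (@tens_bal _ _ _ (fun (v : ldual) b => v * ldual_src b)).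
rewrite -(morph_add_sum (f := fun x => x ⊗ m
   : tensor (fun (v : ldual) b => v * ldual_src b) lM)); last by move=> *; exact: tensDl.
congr tens; apply: ldualP => u.
rewrite (morph_add_sum (f := fun x : ldual => x u)) //.
rewrite {1}(ef u) (morph_add_sum (@ldualD phi)).
by apply: eq_bigr => i _; rewrite ldual_src_lin ldual_mul_src.
Qed.

Lemma ldual_tens_inj (X Y : LDTens) :
  (forall u u', ldual_eval X u u' = ldual_eval Y u u') -> X = Y.
Proof.
move=> XY.
have aD a : {morph (fun v : ldual => v * ldual_tgt a) : x y / x + y}.
  by move=> x y; rewrite mulrDl.
have mD (m : ldual) : {morph (fun a => m * ldual_tgt a) : x y / x + y}.
  move=> x y; rewrite -mulrDr; congr (_ * _).
  by apply: ldualP => u; rewrite ldual_addE /= tgtlD mulrDr epslD.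
have mA (m : ldual) a b : m * ldual_tgt b * ldual_tgt a = m * ldual_tgt (a * b).
  by rewrite -mulrA; case: ldual_tgt_algmap => _ [_ /(_ b a) <-].
rewrite (ldual_tensE aD mD mA X) (ldual_tensE aD mD mA Y).
apply: eq_bigr => i _; congr tens; apply: ldualP => u.
have E (Z : LDTens) : (tlift (fun phi m : ldual => m * ldual_tgt (phi (e i))) Z : ldual) u
    = ldual_eval Z u (e i).
  rewrite (tlift_comp (g := fun x : ldual => x u)) //.
  by apply: eq_tlift => *; rewrite ldual_mul_tgt.
by rewrite !E.
Qed.

Lemma ldual_copP phi u u' : phi (u * u') = ldual_eval (ldual_cop phi) u u'.
Proof.
suff [X XP] : exists X : LDTens, forall u u', phi (u * u') = ldual_eval X u u'.
  by have := @xgetI _ 0 [set X | forall u u', phi (u * u') = ldual_eval X u u'] X XP; exact.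
have phie i : (fun u : U => phi (u * e i)) \in ldual_pred.
  apply/asboolP; split=> [v w|a v] /=; first by rewrite mulrDl ldualD.
  by rewrite -mulrA ldual_src_lin.
exists (\sum_i f i ⊗ LDual (phie i)) => {}u {}u'.
rewrite (morph_add_sum (f := fun X : LDTens => ldual_eval X u u')); last first.
  by move=> *; exact: ldual_evalD.
rewrite {1}(ef u') mulr_sumr (morph_add_sum (@ldualD phi)).
by apply: eq_bigr => i _; rewrite ldual_eval_tens /= mulrA.
Qed.

Lemma ldual_cop_unique phi (X : LDTens) :
  (forall u u', phi (u * u') = ldual_eval X u u') -> ldual_cop phi = X.
Proof. by move=> XP; apply: ldual_tens_inj => u u'; rewrite -ldual_copP -XP. Qed.

Lemma ldual_eval_tmap (g h : ldual -> ldual) (X : LDTens) u u' :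
  ldual_eval (tmap g h X : LDTens) u u' =
  tlift (fun f1 f2 => h f2 (u * s (g f1 u'))) X.
Proof. exact: tlift_tmap. Qed.

Local Notation V := (ldual : algType k).
Local Notation Vc := (V^c).

Lemma ldual_copD : {morph ldual_cop : x y / x + y}.
Proof.
move=> x y; apply: ldual_cop_unique => u u'.
by rewrite ldual_evalD -!ldual_copP.
Qed.

Lemma ldual_eval_src a X u u' :
  ldual_eval (tmap id (fun v => v * ldual_src a) X) u u' = ldual_eval X u u' * a.
Proof.
rewrite ldual_eval_tmap (tlift_comp (g := fun x => x * a)); last first.
  by move=> x y; rewrite mulrDl.
by apply: eq_tlift => *; rewrite ldual_mul_src.
Qed.

Lemma ldual_eval_tgt a X u u' :
  ldual_eval (tmap (fun v => v * ldual_tgt a) id X) u u' = ldual_eval X u (u' * s a).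
Proof. by rewrite ldual_eval_tmap; apply: eq_tlift => *; rewrite ldual_mul_tgt. Qed.

Lemma ldual_cop_mul_tgt phi a :
  ldual_cop (phi * ldual_tgt a) =
  tmap (fun v => v * ldual_tgt a) id (ldual_cop phi).
Proof.
apply: ldual_cop_unique => u u'.
by rewrite ldual_mul_tgt [RHS]ldual_eval_tgt -mulrA ldual_copP.
Qed.

Lemma ldual_cop_mul_src phi a :
  ldual_cop (phi * ldual_src a) =
  tmap id (fun v => v * ldual_src a) (ldual_cop phi).
Proof.
apply: ldual_cop_unique => u u'.
by rewrite ldual_mul_src [RHS]ldual_eval_src ldual_copP.
Qed.

Lemma ldual_cop_takeuchi phi a :
  tmap (fun v => ldual_src a * v) id (ldual_cop phi) =
  tmap id (fun v => ldual_tgt a * v) (ldual_cop phi) :> LDTens.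
Proof.
apply: ldual_tens_inj => u u'; rewrite !ldual_eval_tmap.
transitivity (phi (u * (t a * u'))).
  by rewrite ldual_copP; apply: eq_tlift => *; rewrite ldual_src_mul.
rewrite mulrA ldual_copP; apply: eq_tlift => *.
by rewrite ldual_tgt_mul -mulrA -src_tgtC mulrA.
Qed.

Lemma ldual_cop1 : ldual_cop 1 = 1 ⊗ 1.
Proof.
by apply: ldual_cop_unique => u u'; rewrite ldual_eval_tens !ldual_oneE epslM_src.
Qed.

Lemma ldual_cop_counit phi :
  tlift (fun f1 f2 => f2 * ldual_tgt (ldual_aug f1)) (ldual_cop phi) = phi.
Proof.
apply: ldualP => u; rewrite -[u in RHS]mulr1 ldual_copP.
rewrite (tlift_comp (g := fun x : ldual => x u)) //.
by apply: eq_tlift => f1 f2; rewrite ldual_mul_tgt.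
Qed.

Lemma ldual_cop_counit' phi :
  tlift (fun f1 f2 => f1 * ldual_src (ldual_aug f2)) (ldual_cop phi) = phi.
Proof.
apply: ldualP => u; rewrite -[u in RHS]mul1r ldual_copP.
rewrite (tlift_comp (g := fun x : ldual => x u)) //.
by apply: eq_tlift => f1 f2; rewrite ldual_mul_src mul1r -[s _]mulr1 ldual_src_lin.
Qed.

Lemma ldual_cop_mul phi psi :
  ldual_cop (phi * psi) =
  tlift (fun v v' => tmap (fun u => v * u) (fun u' => v' * u') (ldual_cop psi)
    : LDTens) (ldual_cop phi).
Proof.
apply: ldual_cop_unique => u u'.
rewrite [RHS](tlift_comp (g := fun X : LDTens => ldual_eval X u u')); last first.
  by move=> *; exact: ldual_evalD.
rewrite ldual_mulE tlift_copM; last exact: ldual_mul_balanced.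
transitivity (tlift (fun v1 v2 => tlift (fun u1 u2 =>
    tlift (fun f1 f2 : ldual => psi (t (f2 (u2 * s (f1 v2))) * (u1 * v1))) (ldual_cop phi))
    (Delta u)) (Delta u')).
  apply: eq_tlift => v1 v2; apply: eq_tlift => u1 u2.
  rewrite (ldual_copP phi) -(tlift_comp (g := fun x => psi (t x * (u1 * v1)))) //.
  by move=> x y; rewrite tgtlD mulrDl ldualD.
transitivity (tlift (fun f1 f2 : ldual => tlift (fun v1 v2 => tlift (fun u1 u2 =>
    psi (t (f2 (u2 * s (f1 v2))) * (u1 * v1))) (Delta u)) (Delta u')) (ldual_cop phi)).
  rewrite /tlift; under eq_bigr => p _ do rewrite exchange_big /=.
  by rewrite exchange_big.
apply: eq_tlift => f1 f2; rewrite ldual_eval_tmap.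
transitivity (tlift (fun v1 v2 => tlift (fun u1 u2 => tlift (fun g1 g2 : ldual =>
    g2 (t (f2 u2) * u1 * s (g1 (t (f1 v2) * v1)))) (ldual_cop psi)) (Delta u)) (Delta u')).
  apply: eq_tlift => v1 v2.
  rewrite -(@tlift_takeuchi _ _ _ _ (fun u1 u2 => psi (t (f2 u2) * (u1 * v1)))); last first.
    split=> *; rewrite ?ldualD ?tgtlD ?mulrDl ?mulrDr ?ldualD //.
    by rewrite /ract_tgt /lact_src ldual_src_lin tgtlM !mulrA.
  by apply: eq_tlift => u1 u2; rewrite -mulrA mulrA ldual_copP.
transitivity (tlift (fun g1 g2 : ldual => tlift (fun v1 v2 => tlift (fun u1 u2 =>
    g2 (t (f2 u2) * u1 * s (g1 (t (f1 v2) * v1)))) (Delta u)) (Delta u')) (ldual_cop psi)).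
  rewrite /tlift; under eq_bigr => p _ do rewrite exchange_big /=.
  by rewrite exchange_big.
apply: eq_tlift => g1 g2; rewrite ldual_mulE tlift_cop_mulsrc; last exact: ldual_mul_balanced.
rewrite [LHS]exchange_big /=; apply: eq_bigr => -[u1 u2] _ /=.
rewrite /ldual_mul_fun (tlift_comp srclD).
rewrite [RHS](tlift_comp (g := fun x => g2 (t (f2 u2) * (u1 * x)))).
  by apply: eq_bigr => p _; rewrite mulrA.
by move=> x y; rewrite !mulrDr ldualD.
Qed.

Lemma ldual_Ae_ring_op : @is_Ae_ring k A Vc ldual_tgt ldual_src.
Proof.
case: ldual_Ae_ring => -[sl [s1 sM]] [tl [t1 tM]] st; split.
- by split=> //; split=> // a b; exact: tM.
- by split=> //; split=> // a b; exact: sM.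
- by move=> a b; exact: st.
Qed.

Lemma ldual_coassoc phi :
  @tassoc k A Vc ldual_tgt ldual_src (tmap ldual_cop id (ldual_cop phi)) =
  tmap id ldual_cop (ldual_cop phi).
Proof.
have st := ldual_Ae_ring_op.
set Y := RHS; set X := LHS.
pose lM := @TensA_lact k A Vc ldual_tgt ldual_src.
have evall (Z : LDTens) a u u' : ldual_eval (lM a Z) u u' = ldual_eval Z u (u' * s a).
  exact: ldual_eval_tgt.
have lMDl a : {morph lM a : x y / x + y} by exact: (TensA_lactD st).
have lMDr Z : {morph lM^~ Z : x y / x + y}.
  move=> a b; apply: ldual_tens_inj => u u'.
  rewrite ldual_evalD !evall /ldual_eval /tlift -big_split.
  by apply: eq_bigr => p _; rewrite srclD mulrDr ldualD srclD mulrDr ldualD.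
have lMA Z a b : lM a (lM b Z) = lM (a * b) Z.
  by apply: ldual_tens_inj => u u'; rewrite !evall srclM mulrA.
rewrite (ldual_tensE lMDl lMDr lMA X) (ldual_tensE lMDl lMDr lMA Y).
apply: eq_bigr => i _; congr tens; apply: ldual_tens_inj => u u'.
pose G w (Z : tensor (fun (v : ldual) b => v * ldual_src b) lM) :=
  tlift (fun (h : ldual) y => ldual_eval y u (u' * s (h w))) Z.
have GE w Z : ldual_eval (tlift (fun (h : ldual) y => lM (h w) y) Z) u u' = G w Z.
  rewrite (tlift_comp (g := fun z : LDTens => ldual_eval z u u')).
    by apply: eq_tlift => x h; rewrite evall.
  by move=> *; exact: ldual_evalD.
rewrite !GE.
have bG w : balanced (fun (v : ldual) b => v * ldual_src b) lM
    (fun (h : ldual) y => ldual_eval y u (u' * s (h w))).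
  split=> [h h' y|h x y|h b y]; last 2 first.
  - exact: ldual_evalD.
  - by rewrite evall [in LHS]ldual_mul_src srclM mulrA.
  rewrite srclD mulrDr /ldual_eval /tlift -big_split.
  by apply: eq_bigr => p _; rewrite ldualD srclD mulrDr ldualD.
have -> : G (e i) Y = phi (u * (u' * e i)).
  rewrite /G /Y tlift_tmap // mulrA ldual_copP; apply: eq_tlift => f1 f2.
  by rewrite -ldual_copP mulrA.
rewrite /G /X /tassoc (tlift_comp (tliftD (bG (e i)))).
rewrite ldual_copP.
transitivity (tlift (fun x (h : ldual) => h (u * s (ldual_eval x u' (e i))))
  (tmap ldual_cop id (ldual_cop phi) : tensor (@TensA_ract k A Vc ldual_tgt ldual_src)
     (fun b (v : ldual) => v * ldual_tgt b))).
  apply: eq_tlift => x h; rewrite [LHS](tlift_tmap _ _ _ (bG (e i))).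
  rewrite (tlift_comp (g := fun z => h (u * s z))); last first.
    by move=> *; rewrite srclD mulrDr ldualD.
  by apply: eq_tlift => f1 f2; rewrite ldual_eval_tens.
rewrite tlift_tmap; first by apply: eq_tlift => f1 f2; rewrite -ldual_copP.
split=> [x y h|//|x b h]; first by rewrite ldual_evalD srclD mulrDr ldualD.
by rewrite [in LHS]ldual_eval_src ldual_mul_tgt srclM mulrA.
Qed.

Lemma ldual_is_bialgebroid :
  @is_left_bialgebroid k A Vc ldual_tgt ldual_src ldual_cop ldual_aug.
Proof.
split.
- exact: ldual_Ae_ring_op.
- exact: ldual_copD.
- by move=> a phi; exact: ldual_cop_mul_tgt.
- by move=> a phi; exact: ldual_cop_mul_src.
- by [].
- move=> a phi; rewrite /ldual_aug [LHS]ldual_mul_tgt mul1r -[s a]mulr1.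
  exact: ldual_src_lin.
- by move=> a phi; exact: ldual_mul_src.
- exact: ldual_coassoc.
- exact: ldual_cop_counit.
- exact: ldual_cop_counit'.
- by move=> phi a; exact: ldual_cop_takeuchi.
- exact: ldual_cop1.
- by move=> phi psi; exact: ldual_cop_mul.
- exact: epsl1.
- move=> phi psi; rewrite /ldual_aug [LHS]ldual_mulE [RHS]ldual_tgt_mul mul1r.
  rewrite tlift_cop1 ?mulr1 //; exact: ldual_mul_balanced.
- move=> phi psi; rewrite /ldual_aug [LHS]ldual_mulE [RHS]ldual_src_mul.
  rewrite tlift_cop1 //; exact: ldual_mul_balanced.
Qed.

End DualBasis.

Lemma ldual_bialgebroid_axioms :
  fg_projective (srcmod U) ->
  @is_left_bialgebroid k A ldual^c ldual_tgt ldual_src ldual_cop ldual_aug.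
Proof.
move=> [fg proj]; have [n [e [f [fD fZ ef]]]] := dual_basis fg proj.
have fP i : (f i : U -> A) \in ldual_pred.
  by apply/asboolP; split; [exact: fD | move=> a u; exact: fZ].
exact: (@ldual_is_bialgebroid n e (fun i => LDual (fP i)) ef).
Qed.

End LeftDual.

Record augAeRing (k : comPzRingType) (A : algType k) := AugAeRing {
  aug_sort :> algType k;
  aug_src : A -> aug_sort;
  aug_tgt : A -> aug_sort;
  aug_eps : aug_sort -> A;
  augP : is_Ae_ring aug_src aug_tgt }.

Definition is_augAe_morphism (k : comPzRingType) (A : algType k)
    (V W : augAeRing A) (F : V -> W) : Prop :=
  [/\ is_algmap F,
      forall a, F (aug_src V a) = aug_src W a,
      forall a, F (aug_tgt V a) = aug_tgt W a &
      forall v, aug_eps (F v) = aug_eps v].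

Record is_rb_morphism (k : comPzRingType) (B C : algType k)
    (V : rightBialgebroid B) (W : rightBialgebroid C) (F : V -> W) (f : B -> C) :
    Prop := {
  rbm_alg : is_algmap F;
  rbm_base : is_algmap f;
  rbm_src : forall b, F (srcr V b) = srcr W (f b);
  rbm_tgt : forall b, F (tgtr V b) = tgtr W (f b);
  rbm_cop : forall v, copr (F v) = tmap F F (copr v);
  rbm_eps : forall v, epsr (F v) = f (epsr v) }.
Arguments is_rb_morphism {k B C} V W F f.

Definition rb_isomorphic (k : comPzRingType) (B C : algType k)
    (V : rightBialgebroid B) (W : rightBialgebroid C) : Prop :=
  exists (F : V -> W) (f : B -> C) (G : W -> V) (g : C -> B),
    [/\ is_rb_morphism V W F f, is_rb_morphism W V G g,
        cancel F G /\ cancel G F & cancel f g /\ cancel g f].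

Section Duals.
Variables (k : comPzRingType) (A : algType k) (U : leftBialgebroid A).

Definition rdual_augAe : augAeRing A :=
  @AugAeRing k A (rdual U) (@rdual_src k A U) (@rdual_tgt k A U)
    (@rdual_aug k A U) (rdual_Ae_ring U).

Definition ldual_augAe : augAeRing A :=
  @AugAeRing k A (ldual U) (@ldual_src k A U) (@ldual_tgt k A U)
    (@ldual_aug k A U) (ldual_Ae_ring U).

Definition rdual_bialgebroid (fgp : fg_projective (tgtmod U)) : rightBialgebroid A :=
  @RightBialgebroid k A (rdual U) _ _ _ _ (rdual_bialgebroid_axioms fgp).

Definition ldual_bialgebroid (fgp : fg_projective (srcmod U)) : rightBialgebroid A :=
  @RightBialgebroid k A (ldual U) _ _ _ _ (ldual_bialgebroid_axioms fgp).

End Duals.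

Section HopfGalois.
Variables (k : comPzRingType) (A : algType k) (U : leftBialgebroid A).
Local Notation s := (srcl U).
Local Notation t := (tgtl U).
Local Notation UU := (TensA s t).

Definition hopfl_dom :=
  tensor (fun (u : U) (a : A) => u * t a) (fun (a : A) (v : U) => t a * v).
Definition hopfr_dom :=
  tensor (fun (u : U) (a : A) => u * s a) (fun (a : A) (v : U) => s a * v).
HB.instance Definition _ := GRing.Zmodule.on hopfl_dom.
HB.instance Definition _ := GRing.Zmodule.on hopfr_dom.

Definition alphal : hopfl_dom -> UU :=
  tlift (fun u v => tmap id (fun w => w * v) (copl u) : UU).
Definition alphar : hopfr_dom -> UU :=
  tlift (fun u v => tmap (fun w => w * v) id (copl u) : UU).

Definition left_hopf : Prop := bijective alphal.
Definition right_hopf : Prop := bijective alphar.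

(* The preimages [u_+ ⊗ u_-] and [u_[+] ⊗ u_[-]]; they exist and are unique when
   the Hopf-Galois map is bijective. *)
Definition transl (u : U) : hopfl_dom := xget 0 [set x | alphal x = u ⊗ 1].
Definition transr (u : U) : hopfr_dom := xget 0 [set x | alphar x = 1 ⊗ u].

Definition Sup (phi : rdual U) (u : U) : A :=
  tlift (fun up um => epsl (up * t (phi um))) (transl u).
Definition Sdown (psi : ldual U) (u : U) : A :=
  tlift (fun up um => epsl (up * s (psi um))) (transr u).

Lemma transl_alphal u : left_hopf -> alphal (transl u) = u ⊗ 1.
Proof. by move=> [g _ gK]; exact: (@xgetI _ 0 [set x | alphal x = u ⊗ 1] _ (gK _)). Qed.

Lemma transr_alphar u : right_hopf -> alphar (transr u) = 1 ⊗ u.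
Proof. by move=> [g _ gK]; exact: (@xgetI _ 0 [set x | alphar x = 1 ⊗ u] _ (gK _)). Qed.

Lemma mulr_balancedl v : balanced (ract_tgt t) (lact_src s)
  (fun x y => x ⊗ (y * v) : UU).
Proof.
split=> [x x' y|x y y'|x b y]; rewrite ?mulrDl ?tensDl ?tensDr //.
by rewrite tens_src_tgt mulrA.
Qed.

Lemma mulr_balancedr v : balanced (ract_tgt t) (lact_src s)
  (fun x y => (x * v) ⊗ y : UU).
Proof.
split=> [x x' y|x y y'|x b y]; rewrite ?mulrDl ?tensDl ?tensDr //.
by rewrite -tens_src_tgt mulrA.
Qed.

Lemma alphal_balanced :
  balanced (fun (u : U) (a : A) => u * t a) (fun (a : A) (v : U) => t a * v)
    (fun u v => tmap id (fun w => w * v) (copl u) : UU).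
Proof.
split=> [u u' v|u v v'|u a v]; rewrite /tmap.
- by rewrite coplD (tliftD (mulr_balancedl v)).
- by rewrite /tlift -big_split; apply: eq_bigr => p _; rewrite mulrDr tensDr.
- rewrite (tlift_cop_multgt (mulr_balancedl v)).
  by apply: eq_tlift => x y; rewrite mulrA.
Qed.

Lemma alphar_balanced :
  balanced (fun (u : U) (a : A) => u * s a) (fun (a : A) (v : U) => s a * v)
    (fun u v => tmap (fun w => w * v) id (copl u) : UU).
Proof.
split=> [u u' v|u v v'|u a v]; rewrite /tmap.
- by rewrite coplD (tliftD (mulr_balancedr v)).
- by rewrite /tlift -big_split; apply: eq_bigr => p _; rewrite mulrDr tensDl.
- rewrite (tlift_cop_mulsrc (mulr_balancedr v)).
  by apply: eq_tlift => x y; rewrite mulrA.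
Qed.

Lemma Sup_balanced (phi : rdual U) :
  balanced (fun (u : U) (a : A) => u * t a) (fun (a : A) (v : U) => t a * v)
    (fun up um => epsl (up * t (phi um))).
Proof.
split=> [u u' v|u v v'|u a v]; first by rewrite mulrDl epslD.
  by rewrite rdualD tgtlD mulrDr epslD.
by rewrite rdual_tgt_lin tgtlM mulrA.
Qed.

Lemma Sdown_balanced (psi : ldual U) :
  balanced (fun (u : U) (a : A) => u * s a) (fun (a : A) (v : U) => s a * v)
    (fun up um => epsl (up * s (psi um))).
Proof.
split=> [u u' v|u v v'|u a v]; first by rewrite mulrDl epslD.
  by rewrite ldualD srclD mulrDr epslD.
by rewrite ldual_src_lin srclM mulrA.
Qed.

End HopfGalois.

(* Main.v *)
(* For [phi] in the right dual put [actl phi w z := w_+ t(phi(w_- z))], so that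
   [Sup phi u = eps (actl phi u 1)].  As [alphal] is bijective, [actl phi] is the
   only balanced map with [actl phi u_(1) (u_(2) v) = u t(phi v)]; every property
   of [S^*] is obtained by checking this equation for a candidate, in place of the
   identities satisfied by the translation map.  Writing
   [actl phi w z = t(eps(actl phi w_(2) z)) w_(1)] and
   [actl (phi phi') w z = actl phi' (actl phi w z_(1)) z_(2)] shows that [S^*] is
   multiplicative, and [actl phi (w w') z = p actl phi w' q], where
   [p ⊗ q = alphal^-1 (w ⊗ z)], shows that it is compatible with the coproducts.
   The right Hopf case is the mirror image, with
   [actr psi z w := w_[+] s(psi(w_[-] z))].  Finally
   [eps(u s(S^* phi v)) = eps(u actl phi v 1) = eps(actl phi (u_(1) v) u_(2))]
   says that [eps (actl phi z w)] satisfies the equation that characterizes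
   [eps (actr (S^* phi) z w)]; at [z = 1] this gives [S_* (S^* phi) = phi]. *)

Require Import Defs.
From mathcomp Require Import all_boot all_algebra.
From mathcomp Require Import boolp classical_sets.

Set Implicit Arguments.
Unset Strict Implicit.
Unset Printing Implicit Defensive.

Import GRing.Theory.
Local Open Scope ring_scope.

(** * Balanced maps, and the coproduct on the images of source and target *)

Section Balanced.
Variables (k : comPzRingType) (A : algType k) (U : leftBialgebroid A).
Local Notation s := (srcl U).
Local Notation t := (tgtl U).
Variables (P : zmodType) (f : U -> U -> P).
Hypothesis bf : balanced (ract_tgt t) (lact_src s) f.

Lemma balanced_mulr x y :
  balanced (ract_tgt t) (lact_src s) (fun u v => f (u * x) (v * y)).
Proof.
have [fDl fDr fb] := bf; split=> *; rewrite ?mulrDl ?fDl ?fDr //.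
by rewrite /ract_tgt /lact_src -!mulrA [LHS]fb.
Qed.

Lemma balanced_comp (Q : zmodType) (h : P -> Q) : {morph h : x y / x + y} ->
  balanced (ract_tgt t) (lact_src s) (fun u v => h (f u v)).
Proof. by move=> hD; have [fDl fDr fb] := bf; split=> *; rewrite ?fDl ?fDr ?fb ?hD. Qed.

(** This amounts to [Delta (s a) = s a ⊗ 1]: linearity of the coproduct reduces it to [Delta 1], and
    the lifted map stays balanced because sources commute with targets. *)
Lemma tlift_cop_srcl a : tlift f (copl (s a)) = f (s a) 1.
Proof.
rewrite -[s a]mulr1 tlift_cop_src // tlift_cop1 //.
have [fDl fDr fb] := bf; split=> *; rewrite ?mulrDr ?fDl ?fDr //.
by rewrite -fb /ract_tgt !mulrA src_tgtC.
Qed.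

Lemma tlift_cop_tgtl a : tlift f (copl (t a)) = f 1 (t a).
Proof.
rewrite -[t a]mulr1 tlift_cop_tgt // tlift_cop1 //.
have [fDl fDr fb] := bf; split=> *; rewrite ?mulrDr ?fDl ?fDr //.
by rewrite fb /lact_src !mulrA src_tgtC.
Qed.

End Balanced.

(** * Left Hopf algebroids *)

Section LeftHopf.
Variables (k : comPzRingType) (A : algType k) (U : leftBialgebroid A).
Hypothesis lU : left_hopf U.
Implicit Types (a : A) (u v w z : U) (phi : rdual U).
Local Notation s := (srcl U).
Local Notation t := (tgtl U).
Local Notation Delta := (@copl k A U).
Local Notation eps := (@epsl k A U).
Local Notation UU := (TensA s t).
Local Notation bal := (balanced (ract_tgt t) (lact_src s)).

(** The choice is spelled as in [transl], so that [transl u] is convertible to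
    [galoisl_inv (u ⊗ 1)]; [Sup_actl] relies on this. *)
Definition galoisl_inv (y : UU) : hopfl_dom U := xget 0 [set x | alphal x = y].

Lemma galoisl_invK : cancel galoisl_inv (@alphal k A U).
Proof. by case: lU => g _ gK y; exact: (@xgetI _ 0 [set x | alphal x = y] _ (gK y)). Qed.

Lemma alphalD : {morph @alphal k A U : x y / x + y}.
Proof. exact: tliftD (alphal_balanced U). Qed.

Lemma galoisl_invD : {morph galoisl_inv : x y / x + y}.
Proof. by move=> x y; apply: (bij_inj lU); rewrite alphalD !galoisl_invK. Qed.

Lemma alphalK : cancel (@alphal k A U) galoisl_inv.
Proof. by move=> x; apply: (bij_inj lU); rewrite galoisl_invK. Qed.

Lemma alphal_tens u v :
  alphal (u ⊗ v : hopfl_dom U) = tmap id (fun w => w * v) (Delta u).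
Proof. exact: tlift_tens (alphal_balanced U) _ _. Qed.

Definition actl phi w z : U :=
  tlift (fun p q => p * t (phi q)) (galoisl_inv (w ⊗ z)).

Lemma actl_lift_balanced phi :
  balanced (fun (u : U) (a : A) => u * t a) (fun (a : A) (v : U) => t a * v)
    (fun p q => p * t (phi q)).
Proof.
split=> *; rewrite ?mulrDl ?rdualD ?tgtlD ?mulrDr //.
by rewrite rdual_tgt_lin tgtlM mulrA.
Qed.

Lemma actl_balanced phi : bal (actl phi).
Proof.
have lD := tliftD (actl_lift_balanced phi).
split=> [w w' z|w z z'|w b z]; rewrite /actl.
- by rewrite tensDl galoisl_invD lD.
- by rewrite tensDr galoisl_invD lD.
- by rewrite tens_bal.
Qed.

Lemma actlDl phi z : {morph actl phi ^~ z : u v / u + v}.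
Proof. by move=> u v; have [-> _ _] := actl_balanced phi. Qed.

Lemma actlDr phi w : {morph actl phi w : u v / u + v}.
Proof. by move=> u v; have [_ -> _] := actl_balanced phi. Qed.

Lemma actl_bal phi w a z : actl phi (t a * w) z = actl phi w (s a * z).
Proof. by have [_ _] := actl_balanced phi; apply. Qed.

Lemma tlift_actl phi (y : UU) :
  tlift (actl phi) y = tlift (fun p q => p * t (phi q)) (galoisl_inv y).
Proof.
have lD := tliftD (actl_lift_balanced phi).
move: y; apply: tensor_ind_eq => [||w z]; first exact: tliftD (actl_balanced phi).
  by move=> x y; rewrite galoisl_invD lD.
by rewrite tlift_tens //; exact: actl_balanced.
Qed.

(** [alphal] sends [u ⊗ v] to [u_(1) ⊗ u_(2) v], so applying the inverse to the latter gives back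
    [u ⊗ v]. *)
Lemma actl_cop phi u v :
  tlift (fun u1 u2 => actl phi u1 (u2 * v)) (Delta u) = u * t (phi v).
Proof.
have := tlift_actl phi (alphal (u ⊗ v)); rewrite alphalK.
rewrite tlift_tens; last exact: actl_lift_balanced.
by rewrite alphal_tens tlift_tmap //; exact: actl_balanced.
Qed.

(** Every tensor is some [alphal x], and by additivity [x] may be taken pure, where the hypothesis
    and [actl_cop] agree. The map [h] allows comparison after [eps] or after a left
    multiplication. *)
Lemma actl_unique (P : zmodType) phi (g : U -> U -> P) (h : U -> P) :
  bal g -> {morph h : x y / x + y} ->
  (forall u v, tlift (fun u1 u2 => g u1 (u2 * v)) (Delta u) = h (u * t (phi v))) ->
  forall w z, h (actl phi w z) = g w z.
Proof.
move=> bg hD gh w z; have bh := balanced_comp (actl_balanced phi) hD.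
rewrite -(tlift_tens bg) -(tlift_tens bh) -(galoisl_invK (w ⊗ z)).
move: (galoisl_inv _); apply: tensor_ind_eq => [x y|x y|u v].
- by rewrite alphalD (tliftD bh).
- by rewrite alphalD (tliftD bg).
rewrite alphal_tens (tlift_tmap _ _ _ bh) (tlift_tmap _ _ _ bg) gh.
by rewrite -(tlift_comp hD) actl_cop.
Qed.

Lemma actl1 phi v : actl phi 1 v = t (phi v).
Proof.
rewrite -[RHS]mul1r -actl_cop tlift_cop1 ?mul1r //.
by split=> *; rewrite ?mulrDl ?actlDl ?actlDr // /ract_tgt /lact_src -mulrA actl_bal.
Qed.

(** By uniqueness with [h] the left multiplication by [u]: since [Delta] is multiplicative, the
    equation to check is [actl_cop] for a product [u * p]. *)
Lemma actl_mulcop phi u w z :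
  tlift (fun u1 u2 => actl phi (u1 * w) (u2 * z)) (Delta u) = u * actl phi w z.
Proof.
rewrite (actl_unique (phi := phi) (h := fun x => u * x) (balanced_copM (actl_balanced phi) u)) //.
  by move=> x y; rewrite mulrDr.
move=> p v; rewrite mulrA -actl_cop tlift_copM; last first.
  by split=> *; rewrite ?mulrDl ?actlDl ?actlDr // /ract_tgt /lact_src -mulrA actl_bal.
by apply: eq_tlift => p1 p2; apply: eq_tlift => u1 u2; rewrite mulrA.
Qed.

Lemma actl_src phi a w z : actl phi (s a * w) z = s a * actl phi w z.
Proof.
have b := balanced_mulr (actl_balanced phi) w z.
by rewrite -actl_mulcop (tlift_cop_srcl b) mul1r.
Qed.

Lemma actl_tgt phi a w z : actl phi w (t a * z) = t a * actl phi w z.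
Proof.
have b := balanced_mulr (actl_balanced phi) w z.
by rewrite -actl_mulcop (tlift_cop_tgtl b) mul1r.
Qed.

(** This colinearity lets [actl] be recovered from its composite with [eps], hence from [Sup] when
    [z = 1]. *)
Lemma actl_coact phi w z :
  actl phi w z = tlift (fun w1 w2 => t (eps (actl phi w2 z)) * w1) (Delta w).
Proof.
have b v : bal (fun x y => t (eps (actl phi y v)) * x).
  split=> *; rewrite ?mulrDr ?actlDl ?epslD ?tgtlD ?mulrDl //.
  by rewrite /ract_tgt /lact_src actl_src epsl_src tgtlM mulrA.
apply: (@actl_unique _ phi (fun w z =>
  tlift (fun w1 w2 => t (eps (actl phi w2 z)) * w1) (Delta w)) id) => // [|u v].
  split=> [w1 w2 x|w1 x y|w1 a x].
  - by rewrite coplD (tliftD (b x)).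
  - rewrite /tlift -big_split; apply: eq_bigr => p _.
    by rewrite actlDr epslD tgtlD mulrDl.
  - by rewrite (tlift_cop_tgt (b x)); apply: eq_tlift => *; rewrite actl_bal.
(* Coassociativity gathers the two right legs into a coproduct of [u2], where [actl_cop] applies;
   the right counit then rebuilds [u * t (phi v)]. *)
rewrite (@tlift_coassoc _ _ _ _ (fun x y w => t (eps (actl phi y (w * v))) * x)).
- transitivity (tlift (fun u1 u2 => t (eps (u2 * t (phi v))) * u1) (Delta u)).
    apply: eq_tlift => u1 u2; rewrite -actl_cop.
    rewrite (tlift_comp (g := fun x => t (eps x) * u1)) //.
    by move=> *; rewrite epslD tgtlD mulrDl.
  rewrite -[RHS](@tlift_counitr _ _ _ _ id) // tlift_cop_multgt //.
  split=> *; rewrite ?mulrDr ?epslD ?tgtlD ?mulrDl //.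
  by rewrite /ract_tgt /lact_src epsl_src tgtlM mulrA.
- by move=> x; exact: b.
- move=> x; split=> *; rewrite ?mulrDl ?actlDr ?actlDl ?epslD ?tgtlD ?mulrDl //.
  by rewrite /ract_tgt /lact_src -mulrA actl_bal.
Qed.

(** * Compatibility of [actl] with the product and base maps of the right dual *)

Lemma actl_actl_balanced phi phi' x :
  bal (fun z1 z2 => actl phi' (actl phi x z1) z2).
Proof.
split=> *; rewrite ?actlDr ?actlDl //.
by rewrite /ract_tgt /lact_src actl_tgt actl_bal.
Qed.

Lemma actl_mul phi phi' w z :
  actl (phi * phi') w z =
  tlift (fun z1 z2 => actl phi' (actl phi w z1) z2) (Delta z).
Proof.
have b := actl_actl_balanced phi phi'.
apply: (@actl_unique _ (phi * phi') (fun w z =>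
  tlift (fun z1 z2 => actl phi' (actl phi w z1) z2) (Delta z)) id) => // [|u v].
  split=> [w1 w2 x|w1 x y|w1 a x].
  - by rewrite /tlift -big_split; apply: eq_bigr => p _; rewrite !actlDl.
  - by rewrite coplD (tliftD (b w1)).
  - by rewrite (tlift_cop_src (b w1)); apply: eq_tlift => *; rewrite actl_bal.
transitivity (tlift (fun v1 v2 => tlift (fun u1 u2 => tlift (fun x y =>
   actl phi' (actl phi u1 (x * v1)) (y * v2)) (Delta u2)) (Delta u)) (Delta v)).
  rewrite [RHS]exchange_big /=; apply: eq_bigr => -[u1 u2] _ /=.
  by rewrite (tlift_copM (b u1)).
rewrite rdual_mulE (tlift_comp (g := fun x => u * t x)); last first.
  by move=> *; rewrite tgtlD mulrDr.
apply: eq_tlift => v1 v2.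
rewrite -(@tlift_coassoc _ _ _ _ (fun x y w => actl phi' (actl phi x (y * v1)) (w * v2))).
- transitivity (tlift (fun u1 u2 => actl phi' (u1 * t (phi v1)) (u2 * v2)) (Delta u)).
    apply: eq_tlift => u1 u2; rewrite -actl_cop.
    by rewrite (tlift_comp (g := fun x => actl phi' x (u2 * v2))) //; exact: actlDl.
  (* The Takeuchi condition moves [t (phi v1)] on the first leg to [s (phi v1)] on the second,
     producing the argument [s (phi v1) * v2] of the product of the right dual. *)
  rewrite (@tlift_takeuchi _ _ _ _ (fun x y => actl phi' x (y * v2))).
    by rewrite -actl_cop; apply: eq_tlift => *; rewrite mulrA.
  split=> *; rewrite ?mulrDl ?actlDl ?actlDr //.
  by rewrite /ract_tgt /lact_src -mulrA actl_bal.
- move=> x; split=> *; rewrite ?mulrDl ?actlDr ?actlDl //.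
  by rewrite /ract_tgt /lact_src -mulrA actl_bal.
- move=> x; split=> *; rewrite ?mulrDl ?actlDr ?actlDl //.
  by rewrite /ract_tgt /lact_src -!mulrA actl_tgt actl_bal.
Qed.

Lemma actl_rdual_src a w z : actl (rdual_src U a) w z = t (eps (z * s a)) * w.
Proof.
have b : bal (fun w z => t (eps (z * s a)) * w).
  split=> *; rewrite ?mulrDr ?mulrDl ?epslD ?tgtlD ?mulrDl //.
  by rewrite /ract_tgt /lact_src -mulrA epsl_src tgtlM mulrA.
apply: (@actl_unique _ _ (fun w z => t (eps (z * s a)) * w) id) => // u v.
rewrite -[RHS](@tlift_counitr _ _ _ _ id) // tlift_cop_multgt /=.
  by apply: eq_tlift => u1 u2; rewrite -epslM_tgt mulrA.
split=> *; rewrite ?mulrDr ?epslD ?tgtlD ?mulrDl //.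
by rewrite /ract_tgt /lact_src epsl_src tgtlM mulrA.
Qed.

Lemma actl_rdual_tgt a w z : actl (rdual_tgt U a) w z = t (eps z) * w * t a.
Proof.
have b : bal (fun w z => t (eps z) * w * t a).
  split=> *; rewrite ?mulrDr ?mulrDl ?epslD ?tgtlD ?mulrDl //.
  by rewrite /ract_tgt /lact_src epsl_src tgtlM !mulrA.
apply: (@actl_unique _ _ (fun w z => t (eps z) * w * t a) id) => // u v; rewrite /= tgtlM mulrA.
rewrite -[u in RHS]mulr1 -[X in X * t a](@tlift_counitr _ _ _ _ id) // mulr1.
rewrite tlift_cop_multgt; last first.
  split=> *; rewrite ?mulrDr ?epslD ?tgtlD ?mulrDl //.
  by rewrite /ract_tgt /lact_src epsl_src tgtlM mulrA.
rewrite [RHS](tlift_comp (g := fun x => x * t a)); last by move=> *; rewrite mulrDl.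
by apply: eq_tlift => u1 u2; rewrite -epslM_tgt.
Qed.

(** After writing [w ⊗ z] as a sum of terms [alphal (u ⊗ v)], each term is an instance of
    [actl_mulcop]. *)
Lemma actl_mull phi w w' z :
  actl phi (w * w') z =
  tlift (fun p q => p * actl phi w' q) (galoisl_inv (w ⊗ z)).
Proof.
have b : bal (fun x y => actl phi (x * w') y).
  split=> *; rewrite ?mulrDl ?actlDl ?actlDr //.
  by rewrite /ract_tgt /lact_src -mulrA actl_bal.
have b' : balanced (fun (u : U) (a : A) => u * t a) (fun (a : A) (v : U) => t a * v)
    (fun p q => p * actl phi w' q).
  by split=> *; rewrite ?actlDr ?mulrDl ?mulrDr // actl_tgt mulrA.
rewrite -[LHS](tlift_tens b) -[w ⊗ z in LHS]galoisl_invK.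
move: (galoisl_inv _); apply: tensor_ind_eq => [x y||u v].
- by rewrite alphalD (tliftD b).
- exact: tliftD b'.
by rewrite alphal_tens (tlift_tmap _ _ _ b) (tlift_tens b') -actl_mulcop.
Qed.

Lemma actl_addfun phi phi' w z : actl (phi + phi') w z = actl phi w z + actl phi' w z.
Proof.
rewrite /actl /tlift -big_split; apply: eq_bigr => p _.
by rewrite rdual_addE tgtlD mulrDr.
Qed.

(** The left side, as a function of [w] and [x], solves the equation characterizing [actl phi']. *)
Lemma actl_mulr phi phi' w x z :
  (forall v, phi' v = phi (v * z)) -> actl phi w (x * z) = actl phi' w x.
Proof.
move=> phiE; apply/esym.
apply: (@actl_unique _ phi' (fun w x => actl phi w (x * z)) id) => // [|u v].
  split=> *; rewrite ?mulrDl ?actlDl ?actlDr //.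
  by rewrite /ract_tgt /lact_src -mulrA actl_bal.
by rewrite phiE -actl_cop; apply: eq_tlift => *; rewrite mulrA.
Qed.

Lemma actl_mul_src phi a w : actl (phi * rdual_src U a) w 1 = t a * actl phi w 1.
Proof.
rewrite actl_mul tlift_cop1; last exact: actl_actl_balanced.
by rewrite actl_rdual_src mul1r epsl_s.
Qed.

Lemma actl_sum phi (X : RDTens U) w z :
  (forall v, phi (v * z) = rdual_eval X v z) ->
  actl phi w z = tlift (fun phi1 phi2 : rdual U => t (phi2 z) * actl phi1 w 1) X.
Proof.
(* [phi'] is the functional sending [v] to [phi (v * z)], written as a sum of products in the dual
   so that additivity of [actl] in the functional and [actl_mul_src] apply. *)
move=> phiX; pose phi' : rdual U := tlift (fun f g : rdual U => f * rdual_src U (g z)) X.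
have phi'E v : phi' v = phi (v * z).
  rewrite phiX /phi' (tlift_comp (g := fun x : rdual U => x v)) //.
  by apply: eq_tlift => *; rewrite rdual_mul_src.
rewrite -[z in LHS]mul1r (actl_mulr _ _ phi'E) /phi'.
rewrite (tlift_comp (g := fun x : rdual U => actl x w 1)).
  by apply: eq_tlift => *; rewrite actl_mul_src.
by move=> *; exact: actl_addfun.
Qed.

(** Through [actl_mull] the operator acts only on the factor [s a], with value [s a * t (phi q)],
    and sources commute with targets. *)
Lemma actl_mulsrc phi u a : actl phi (u * s a) 1 = actl phi u 1 * s a.
Proof.
rewrite actl_mull [in RHS]/actl (tlift_comp (g := fun x => x * s a)).
  apply: eq_tlift => p q.
  by rewrite -[s a in LHS]mulr1 actl_src actl1 src_tgtC mulrA.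
by move=> *; rewrite mulrDl.
Qed.

(** * The map [S^*] from the right dual to the left dual *)

Lemma Sup_actl phi u : Sup phi u = eps (actl phi u 1).
Proof. by rewrite /actl (tlift_comp epslD). Qed.

Lemma Sup_subproof phi : (Sup phi : U -> A) \in @ldual_pred k A U.
Proof.
apply/asboolP; split=> [u v|a u]; first by rewrite !Sup_actl actlDl epslD.
by rewrite !Sup_actl actl_src epsl_src.
Qed.

Definition Supl phi : ldual U := LDual (Sup_subproof phi).

Lemma Supl_linear : linear Supl.
Proof.
move=> c f g; apply: ldualP => u; rewrite ldual_addE ldual_scaleE /= /Sup /tlift.
rewrite scaler_sumr -big_split; apply: eq_bigr => p _.
by rewrite rdual_addE rdual_scaleE tgtlD tgtlZ mulrDr -scalerAr epslD epslZ.
Qed.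

Lemma Supl_src a : Supl (rdual_src U a) = ldual_src U a.
Proof.
by apply: ldualP => u; rewrite /= Sup_actl actl_rdual_src mul1r epsl_s epsl_tgt.
Qed.

Lemma Supl_tgt a : Supl (rdual_tgt U a) = ldual_tgt U a.
Proof.
by apply: ldualP => u; rewrite /= Sup_actl actl_rdual_tgt epsl1 tgtl1 mul1r.
Qed.

(** At [z = 1], [actl_mul] becomes the composite [actl g (actl f u 1) 1]; [actl_coact] expands the
    inner value into the argument occurring in the product of the left dual. *)
Lemma SuplM : {morph Supl : f g / f * g}.
Proof.
move=> f g; apply: ldualP => u; rewrite ldual_mulE /= Sup_actl actl_mul.
rewrite tlift_cop1; last exact: actl_actl_balanced.
rewrite -Sup_actl (actl_coact f) (tlift_comp (g := @Sup k A U g)).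
  by apply: eq_tlift => *; rewrite -Sup_actl.
by move=> x y; rewrite !Sup_actl actlDl epslD.
Qed.

Lemma Supl1 : Supl 1 = 1.
Proof.
(* The unit of each dual is the source of [1]. *)
have [_ [<- _]] := rdual_src_algmap U; rewrite Supl_src.
by have [_ [<- _]] := ldual_src_algmap U.
Qed.

Lemma Supl_algmap : is_algmap Supl.
Proof. by split; [exact: Supl_linear | split; [exact: Supl1 | exact: SuplM]]. Qed.

Lemma Supl_aug phi : ldual_aug (Supl phi) = rdual_aug phi.
Proof. by rewrite /ldual_aug /= Sup_actl actl1 epsl_t. Qed.

(** A tensor representing the coproduct of [phi] is carried to one representing that of [Supl phi].
    Both sides reduce to the sum over [f ⊗ g] in [X] of [eps (actl g u 1 * actl f u' 1)]. *)
Lemma Supl_eval phi (X : RDTens U) u u' :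
  (forall u u', phi (u * u') = rdual_eval X u u') ->
  Supl phi (u * u') = ldual_eval (tmap Supl Supl X) u u'.
Proof.
move=> phiX; rewrite /ldual_eval tlift_tmap; last exact: ldual_eval_balanced.
rewrite /= Sup_actl actl_mull.
transitivity (tlift (fun p q => tlift (fun f g : rdual U =>
    eps (p * t (g q) * actl f u' 1)) X) (galoisl_inv (u ⊗ 1))).
  rewrite (tlift_comp epslD); apply: eq_tlift => p q.
  rewrite (actl_sum _ (fun v => phiX v q)) (tlift_comp (g := fun x => eps (p * x))).
    by apply: eq_tlift => *; rewrite mulrA.
  by move=> *; rewrite mulrDr epslD.
rewrite [LHS]exchange_big /=; apply: eq_bigr => -[f g] _ /=.
(* [actl_mulsrc] releases the source factor from the argument, and the counit axiom then absorbs [s]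
   and the inner [eps]. *)
rewrite !Sup_actl actl_mulsrc -epslM_src.
rewrite [in RHS]/actl (tlift_comp (g := fun x => eps (x * actl f u' 1))) //.
by move=> *; rewrite mulrDl epslD.
Qed.

End LeftHopf.

(** * Right Hopf algebroids *)

Section RightHopf.
Variables (k : comPzRingType) (A : algType k) (U : leftBialgebroid A).
Hypothesis rU : right_hopf U.
Implicit Types (a : A) (u v w z : U) (psi : ldual U).
Local Notation s := (srcl U).
Local Notation t := (tgtl U).
Local Notation Delta := (@copl k A U).
Local Notation eps := (@epsl k A U).
Local Notation UU := (TensA s t).
Local Notation bal := (balanced (ract_tgt t) (lact_src s)).

(** As on the left side, [transr u] is convertible to [galoisr_inv (1 ⊗ u)]. *)
Definition galoisr_inv (y : UU) : hopfr_dom U := xget 0 [set x | alphar x = y].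

Lemma galoisr_invK : cancel galoisr_inv (@alphar k A U).
Proof. by case: rU => g _ gK y; exact: (@xgetI _ 0 [set x | alphar x = y] _ (gK y)). Qed.

Lemma alpharD : {morph @alphar k A U : x y / x + y}.
Proof. exact: tliftD (alphar_balanced U). Qed.

Lemma galoisr_invD : {morph galoisr_inv : x y / x + y}.
Proof. by move=> x y; apply: (bij_inj rU); rewrite alpharD !galoisr_invK. Qed.

Lemma alpharK : cancel (@alphar k A U) galoisr_inv.
Proof. by move=> x; apply: (bij_inj rU); rewrite galoisr_invK. Qed.

Lemma alphar_tens u v :
  alphar (u ⊗ v : hopfr_dom U) = tmap (fun w => w * v) id (Delta u).
Proof. exact: tlift_tens (alphar_balanced U) _ _. Qed.

Definition actr psi z w : U :=
  tlift (fun p q => p * s (psi q)) (galoisr_inv (z ⊗ w)).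

Lemma actr_lift_balanced psi :
  balanced (fun (u : U) (a : A) => u * s a) (fun (a : A) (v : U) => s a * v)
    (fun p q => p * s (psi q)).
Proof.
split=> *; rewrite ?mulrDl ?ldualD ?srclD ?mulrDr //.
by rewrite ldual_src_lin srclM mulrA.
Qed.

Lemma actr_balanced psi : bal (actr psi).
Proof.
have lD := tliftD (actr_lift_balanced psi).
split=> [w w' z|w z z'|w b z]; rewrite /actr.
- by rewrite tensDl galoisr_invD lD.
- by rewrite tensDr galoisr_invD lD.
- by rewrite tens_bal.
Qed.

Lemma actrDl psi w : {morph actr psi ^~ w : u v / u + v}.
Proof. by move=> u v; have [-> _ _] := actr_balanced psi. Qed.

Lemma actrDr psi z : {morph actr psi z : u v / u + v}.
Proof. by move=> u v; have [_ -> _] := actr_balanced psi. Qed.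

Lemma actr_bal psi z a w : actr psi (t a * z) w = actr psi z (s a * w).
Proof. by have [_ _] := actr_balanced psi; apply. Qed.

Lemma tlift_actr psi (y : UU) :
  tlift (actr psi) y = tlift (fun p q => p * s (psi q)) (galoisr_inv y).
Proof.
have lD := tliftD (actr_lift_balanced psi).
move: y; apply: tensor_ind_eq => [||w z]; first exact: tliftD (actr_balanced psi).
  by move=> x y; rewrite galoisr_invD lD.
by rewrite tlift_tens //; exact: actr_balanced.
Qed.

Lemma actr_cop psi u v :
  tlift (fun u1 u2 => actr psi (u1 * v) u2) (Delta u) = u * s (psi v).
Proof.
have := tlift_actr psi (alphar (u ⊗ v)); rewrite alpharK.
rewrite tlift_tens; last exact: actr_lift_balanced.
by rewrite alphar_tens tlift_tmap //; exact: actr_balanced.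
Qed.

(** Mirror of [actl_unique]: surjectivity of [alphar] reduces the claim to the tensors
    [u_(1) v ⊗ u_(2)]. *)
Lemma actr_unique (P : zmodType) psi (g : U -> U -> P) (h : U -> P) :
  bal g -> {morph h : x y / x + y} ->
  (forall u v, tlift (fun u1 u2 => g (u1 * v) u2) (Delta u) = h (u * s (psi v))) ->
  forall z w, h (actr psi z w) = g z w.
Proof.
move=> bg hD gh z w; have bh := balanced_comp (actr_balanced psi) hD.
rewrite -(tlift_tens bg) -(tlift_tens bh) -(galoisr_invK (z ⊗ w)).
move: (galoisr_inv _); apply: tensor_ind_eq => [x y|x y|u v].
- by rewrite alpharD (tliftD bh).
- by rewrite alpharD (tliftD bg).
rewrite alphar_tens (tlift_tmap _ _ _ bh) (tlift_tmap _ _ _ bg) gh.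
by rewrite -(tlift_comp hD) actr_cop.
Qed.

Lemma actr1 psi v : actr psi v 1 = s (psi v).
Proof.
rewrite -[RHS]mul1r -actr_cop tlift_cop1 ?mul1r //.
by split=> *; rewrite ?mulrDl ?actrDl ?actrDr // /ract_tgt /lact_src -mulrA actr_bal.
Qed.

Lemma actr_mulcop psi u z w :
  tlift (fun u1 u2 => actr psi (u1 * z) (u2 * w)) (Delta u) = u * actr psi z w.
Proof.
rewrite (actr_unique (psi := psi) (h := fun x => u * x) (balanced_copM (actr_balanced psi) u)) //.
  by move=> x y; rewrite mulrDr.
move=> p v; rewrite mulrA -actr_cop tlift_copM; last first.
  by split=> *; rewrite ?mulrDl ?actrDl ?actrDr // /ract_tgt /lact_src -mulrA actr_bal.
by apply: eq_tlift => p1 p2; apply: eq_tlift => u1 u2; rewrite mulrA.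
Qed.

Lemma actr_tgt psi a z w : actr psi z (t a * w) = t a * actr psi z w.
Proof.
have b := balanced_mulr (actr_balanced psi) z w.
by rewrite -actr_mulcop (tlift_cop_tgtl b) mul1r.
Qed.

Lemma actr_src psi a z w : actr psi (s a * z) w = s a * actr psi z w.
Proof.
have b := balanced_mulr (actr_balanced psi) z w.
by rewrite -actr_mulcop (tlift_cop_srcl b) mul1r.
Qed.

Lemma actr_coact psi z w :
  actr psi z w = tlift (fun w1 w2 => s (eps (actr psi z w1)) * w2) (Delta w).
Proof.
have b v : bal (fun x y => s (eps (actr psi v x)) * y).
  split=> *; rewrite ?mulrDr ?actrDr ?epslD ?srclD ?mulrDl //.
  by rewrite /ract_tgt /lact_src actr_tgt epsl_tgt srclM mulrA.
apply: (@actr_unique _ psi (fun z w =>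
  tlift (fun w1 w2 => s (eps (actr psi z w1)) * w2) (Delta w)) id) => // [|u v].
  split=> [x y w1|x w1 w2|x a w1].
  - rewrite /tlift -big_split; apply: eq_bigr => p _.
    by rewrite actrDl epslD srclD mulrDl.
  - by rewrite coplD (tliftD (b x)).
  - by rewrite (tlift_cop_src (b x)); apply: eq_tlift => *; rewrite actr_bal.
(* Here the two left legs are gathered into a coproduct of [u1], and the left counit rebuilds
   [u * s (psi v)]. *)
rewrite -(@tlift_coassoc _ _ _ _ (fun x y w => s (eps (actr psi (x * v) y)) * w)).
- transitivity (tlift (fun u1 u2 => s (eps (u1 * s (psi v))) * u2) (Delta u)).
    apply: eq_tlift => u1 u2; rewrite -actr_cop.
    rewrite (tlift_comp (g := fun x => s (eps x) * u2)) //.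
    by move=> *; rewrite epslD srclD mulrDl.
  rewrite -[RHS](@tlift_counitl _ _ _ _ id) // tlift_cop_mulsrc //.
  split=> *; rewrite ?mulrDr ?epslD ?srclD ?mulrDl //.
  by rewrite /ract_tgt /lact_src epsl_tgt srclM mulrA.
- move=> x; split=> *; rewrite ?mulrDl ?actrDr ?actrDl ?epslD ?srclD ?mulrDl //.
  by rewrite /ract_tgt /lact_src -mulrA actr_bal.
- by move=> x; exact: b.
Qed.

(** * Compatibility of [actr] with the product and base maps of the left dual *)

Lemma actr_actr_balanced psi psi' x :
  bal (fun z1 z2 => actr psi' z1 (actr psi z2 x)).
Proof.
split=> *; rewrite ?actrDr ?actrDl ?actrDr //.
by rewrite /ract_tgt /lact_src actr_src actr_bal.
Qed.

Lemma actr_mul psi psi' z w :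
  actr (psi * psi') z w =
  tlift (fun z1 z2 => actr psi' z1 (actr psi z2 w)) (Delta z).
Proof.
have b := actr_actr_balanced psi psi'.
apply: (@actr_unique _ (psi * psi') (fun z w =>
  tlift (fun z1 z2 => actr psi' z1 (actr psi z2 w)) (Delta z)) id) => // [|u v].
  split=> [x y w1|x w1 w2|x a w1].
  - by rewrite coplD (tliftD (b w1)).
  - by rewrite /tlift -big_split; apply: eq_bigr => p _; rewrite !actrDr.
  - by rewrite (tlift_cop_tgt (b w1)); apply: eq_tlift => *; rewrite actr_bal.
transitivity (tlift (fun v1 v2 => tlift (fun u1 u2 => tlift (fun x y =>
   actr psi' (x * v1) (actr psi (y * v2) u2)) (Delta u1)) (Delta u)) (Delta v)).
  rewrite [RHS]exchange_big /=; apply: eq_bigr => -[u1 u2] _ /=.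
  by rewrite (tlift_copM (b u2)).
rewrite ldual_mulE (tlift_comp (g := fun x => u * s x)); last first.
  by move=> *; rewrite srclD mulrDr.
apply: eq_tlift => v1 v2.
rewrite (@tlift_coassoc _ _ _ _ (fun x y w => actr psi' (x * v1) (actr psi (y * v2) w))).
- transitivity (tlift (fun u1 u2 => actr psi' (u1 * v1) (u2 * s (psi v2))) (Delta u)).
    apply: eq_tlift => u1 u2; rewrite -actr_cop.
    by rewrite (tlift_comp (g := actr psi' (u1 * v1))) //; exact: actrDr.
  (* The Takeuchi condition is used from right to left: [s (psi v2)] on the second leg becomes
     [t (psi v2)] on the first. *)
  rewrite -(@tlift_takeuchi _ _ _ _ (fun x y => actr psi' (x * v1) y)).
    by rewrite -actr_cop; apply: eq_tlift => *; rewrite mulrA.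
  split=> *; rewrite ?mulrDl ?actrDl ?actrDr //.
  by rewrite /ract_tgt /lact_src -mulrA actr_bal.
- move=> x; split=> *; rewrite ?mulrDl ?actrDr ?actrDl ?actrDr //.
  by rewrite /ract_tgt /lact_src -!mulrA actr_src actr_bal.
- move=> x; split=> *; rewrite ?mulrDl ?actrDr ?actrDl ?actrDr //.
  by rewrite /ract_tgt /lact_src -mulrA actr_bal.
Qed.

Lemma actr_ldual_tgt a z w : actr (ldual_tgt U a) z w = s (eps (z * t a)) * w.
Proof.
have b : bal (fun z w => s (eps (z * t a)) * w).
  split=> *; rewrite ?mulrDr ?mulrDl ?epslD ?srclD ?mulrDl //.
  by rewrite /ract_tgt /lact_src -mulrA epsl_tgt srclM mulrA.
apply: (@actr_unique _ _ (fun z w => s (eps (z * t a)) * w) id) => // u v.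
rewrite -[RHS](@tlift_counitl _ _ _ _ id) // tlift_cop_mulsrc /=.
  by apply: eq_tlift => u1 u2; rewrite -epslM_src mulrA.
split=> *; rewrite ?mulrDr ?epslD ?srclD ?mulrDl //.
by rewrite /ract_tgt /lact_src epsl_tgt srclM mulrA.
Qed.

Lemma actr_ldual_src a z w : actr (ldual_src U a) z w = s (eps z) * w * s a.
Proof.
have b : bal (fun z w => s (eps z) * w * s a).
  split=> *; rewrite ?mulrDr ?mulrDl ?epslD ?srclD ?mulrDl //.
  by rewrite /ract_tgt /lact_src epsl_tgt srclM !mulrA.
apply: (@actr_unique _ _ (fun z w => s (eps z) * w * s a) id) => // u v.
rewrite /= srclM mulrA -[u * s (eps v)](@tlift_counitl _ _ _ _ id) //.
rewrite tlift_cop_mulsrc; last first.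
  split=> *; rewrite ?mulrDr ?epslD ?srclD ?mulrDl //.
  by rewrite /ract_tgt /lact_src epsl_tgt srclM mulrA.
rewrite [RHS](tlift_comp (g := fun x => x * s a)); last by move=> *; rewrite mulrDl.
by apply: eq_tlift => u1 u2; rewrite -epslM_src.
Qed.

Lemma actr_mull psi z w w' :
  actr psi z (w * w') =
  tlift (fun p q => p * actr psi q w') (galoisr_inv (z ⊗ w)).
Proof.
have b : bal (fun x y => actr psi x (y * w')).
  split=> *; rewrite ?mulrDl ?actrDl ?actrDr //.
  by rewrite /ract_tgt /lact_src -mulrA actr_bal.
have b' : balanced (fun (u : U) (a : A) => u * s a) (fun (a : A) (v : U) => s a * v)
    (fun p q => p * actr psi q w').
  by split=> *; rewrite ?actrDl ?mulrDl ?mulrDr // actr_src mulrA.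
rewrite -[LHS](tlift_tens b) -[z ⊗ w in LHS]galoisr_invK.
move: (galoisr_inv _); apply: tensor_ind_eq => [x y||u v].
- by rewrite alpharD (tliftD b).
- exact: tliftD b'.
by rewrite alphar_tens (tlift_tmap _ _ _ b) (tlift_tens b') -actr_mulcop.
Qed.

Lemma actr_addfun psi psi' z w : actr (psi + psi') z w = actr psi z w + actr psi' z w.
Proof.
rewrite /actr /tlift -big_split; apply: eq_bigr => p _.
by rewrite ldual_addE srclD mulrDr.
Qed.

Lemma actr_mulr psi psi' x w z :
  (forall v, psi' v = psi (v * z)) -> actr psi (x * z) w = actr psi' x w.
Proof.
move=> psiE; apply/esym.
apply: (@actr_unique _ psi' (fun x w => actr psi (x * z) w) id) => // [|u v].
  split=> *; rewrite ?mulrDl ?actrDl ?actrDr //.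
  by rewrite /ract_tgt /lact_src -mulrA actr_bal.
by rewrite psiE -actr_cop; apply: eq_tlift => *; rewrite mulrA.
Qed.

Lemma actr_mul_tgt psi a w : actr (psi * ldual_tgt U a) 1 w = s a * actr psi 1 w.
Proof.
rewrite actr_mul tlift_cop1; last exact: actr_actr_balanced.
by rewrite actr_ldual_tgt mul1r epsl_t.
Qed.

Lemma actr_sum psi (X : LDTens U) z w :
  (forall v, psi (v * z) = ldual_eval X v z) ->
  actr psi z w = tlift (fun psi1 psi2 : ldual U => s (psi1 z) * actr psi2 1 w) X.
Proof.
(* Again [psi'] sends [v] to [psi (v * z)]; the roles of [f] and [g] are exchanged because the
   pairing of the left dual evaluates the first factor innermost. *)
move=> psiX; pose psi' : ldual U := tlift (fun f g : ldual U => g * ldual_tgt U (f z)) X.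
have psi'E v : psi' v = psi (v * z).
  rewrite psiX /psi' (tlift_comp (g := fun x : ldual U => x v)) //.
  by apply: eq_tlift => *; rewrite ldual_mul_tgt.
rewrite -[z in LHS]mul1r (actr_mulr _ _ psi'E) /psi'.
rewrite (tlift_comp (g := fun x : ldual U => actr x 1 w)).
  by apply: eq_tlift => *; rewrite actr_mul_tgt.
by move=> *; exact: actr_addfun.
Qed.

Lemma actr_multgt psi u a : actr psi 1 (u * t a) = actr psi 1 u * t a.
Proof.
rewrite actr_mull [in RHS]/actr (tlift_comp (g := fun x => x * t a)).
  apply: eq_tlift => p q.
  by rewrite -[t a in LHS]mulr1 actr_tgt actr1 -src_tgtC mulrA.
by move=> *; rewrite mulrDl.
Qed.

(** * The map [S_*] from the left dual to the right dual *)

Lemma Sdown_actr psi u : Sdown psi u = eps (actr psi 1 u).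
Proof. by rewrite /actr (tlift_comp epslD). Qed.

Lemma Sdown_subproof psi : (Sdown psi : U -> A) \in @rdual_pred k A U.
Proof.
apply/asboolP; split=> [u v|a u]; first by rewrite !Sdown_actr actrDr epslD.
by rewrite !Sdown_actr actr_tgt epsl_tgt.
Qed.

Definition Sdownr psi : rdual U := RDual (Sdown_subproof psi).

Lemma Sdownr_linear : linear Sdownr.
Proof.
move=> c f g; apply: rdualP => u; rewrite rdual_addE rdual_scaleE /= /Sdown /tlift.
rewrite scaler_sumr -big_split; apply: eq_bigr => p _.
by rewrite ldual_addE ldual_scaleE srclD srclZ mulrDr -scalerAr epslD epslZ.
Qed.

Lemma Sdownr_src a : Sdownr (ldual_src U a) = rdual_src U a.
Proof.
by apply: rdualP => u; rewrite /= Sdown_actr actr_ldual_src epsl1 srcl1 mul1r.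
Qed.

Lemma Sdownr_tgt a : Sdownr (ldual_tgt U a) = rdual_tgt U a.
Proof.
by apply: rdualP => u; rewrite /= Sdown_actr actr_ldual_tgt mul1r epsl_t epsl_src.
Qed.

Lemma SdownrM : {morph Sdownr : f g / f * g}.
Proof.
move=> f g; apply: rdualP => u; rewrite rdual_mulE /= Sdown_actr actr_mul.
rewrite tlift_cop1; last exact: actr_actr_balanced.
rewrite -Sdown_actr (actr_coact f) (tlift_comp (g := @Sdown k A U g)).
  by apply: eq_tlift => *; rewrite -Sdown_actr.
by move=> x y; rewrite !Sdown_actr actrDr epslD.
Qed.

Lemma Sdownr1 : Sdownr 1 = 1.
Proof.
have [_ [<- _]] := ldual_src_algmap U; rewrite Sdownr_src.
by have [_ [<- _]] := rdual_src_algmap U.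
Qed.

Lemma Sdownr_algmap : is_algmap Sdownr.
Proof. by split; [exact: Sdownr_linear | split; [exact: Sdownr1 | exact: SdownrM]]. Qed.

Lemma Sdownr_aug psi : rdual_aug (Sdownr psi) = ldual_aug psi.
Proof. by rewrite /rdual_aug /= Sdown_actr actr1 epsl_s. Qed.

(** Both sides reduce to the sum over [f ⊗ g] in [X] of [eps (actr f 1 u * actr g 1 u')]. *)
Lemma Sdownr_eval psi (X : LDTens U) u u' :
  (forall u u', psi (u * u') = ldual_eval X u u') ->
  Sdownr psi (u * u') = rdual_eval (tmap Sdownr Sdownr X) u u'.
Proof.
move=> psiX; rewrite /rdual_eval tlift_tmap; last exact: rdual_eval_balanced.
rewrite /= Sdown_actr actr_mull.
transitivity (tlift (fun p q => tlift (fun f g : ldual U =>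
    eps (p * s (f q) * actr g 1 u')) X) (galoisr_inv (1 ⊗ u))).
  rewrite (tlift_comp epslD); apply: eq_tlift => p q.
  rewrite (actr_sum _ (fun v => psiX v q)) (tlift_comp (g := fun x => eps (p * x))).
    by apply: eq_tlift => *; rewrite mulrA.
  by move=> *; rewrite mulrDr epslD.
rewrite [LHS]exchange_big /=; apply: eq_bigr => -[f g] _ /=.
rewrite !Sdown_actr actr_multgt -epslM_tgt.
rewrite [in RHS]/actr (tlift_comp (g := fun x => eps (x * actr g 1 u'))) //.
by move=> *; rewrite mulrDl epslD.
Qed.

End RightHopf.

(** * Morphisms between the duals *)

Section Morphisms.
Variables (k : comPzRingType) (A : algType k) (U : leftBialgebroid A).
Local Notation s := (srcl U).
Local Notation t := (tgtl U).
Local Notation eps := (@epsl k A U).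

Lemma Supl_augAe (lU : left_hopf U) :
  is_augAe_morphism (V := rdual_augAe U) (W := ldual_augAe U) (Supl lU).
Proof.
split; [exact: Supl_algmap | exact: Supl_src | exact: Supl_tgt | exact: Supl_aug].
Qed.

Lemma Sdownr_augAe (rU : right_hopf U) :
  is_augAe_morphism (V := ldual_augAe U) (W := rdual_augAe U) (Sdownr rU).
Proof.
split; [exact: Sdownr_algmap | exact: Sdownr_src | exact: Sdownr_tgt | exact: Sdownr_aug].
Qed.

(** The coordinate functionals are packaged as elements of the dual, the form that [rdual_copP] and
    [rdual_cop_unique] take. *)
Lemma tgtmod_dual_basis : fg_projective (tgtmod U) ->
  exists (n : nat) (e : 'I_n -> U) (f : 'I_n -> rdual U),
    forall u, u = \sum_i t (f i u) * e i.
Proof.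
move=> [fg proj]; have [n [e [f [fD fZ ef]]]] := dual_basis fg proj.
have fP i : (f i : U -> A) \in @rdual_pred k A U.
  by apply/asboolP; split; [exact: fD | move=> a v; exact: fZ].
by exists n, e, (fun i => RDual (fP i)).
Qed.

Lemma srcmod_dual_basis : fg_projective (srcmod U) ->
  exists (n : nat) (e : 'I_n -> U) (f : 'I_n -> ldual U),
    forall u, u = \sum_i s (f i u) * e i.
Proof.
move=> [fg proj]; have [n [e [f [fD fZ ef]]]] := dual_basis fg proj.
have fP i : (f i : U -> A) \in @ldual_pred k A U.
  by apply/asboolP; split; [exact: fD | move=> a v; exact: fZ].
by exists n, e, (fun i => LDual (fP i)).
Qed.

Lemma Supl_rb_morphism (lU : left_hopf U)
    (fgs : fg_projective (srcmod U)) (fgt : fg_projective (tgtmod U)) :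
  is_rb_morphism (rdual_bialgebroid fgt) (ldual_bialgebroid fgs) (Supl lU) id.
Proof.
have [n [e [f ef]]] := srcmod_dual_basis fgs.
have [m [e' [f' ef']]] := tgtmod_dual_basis fgt.
split.
- exact: Supl_algmap.
- by [].
- exact: Supl_src.
- exact: Supl_tgt.
(* The basis of [srcmod U] makes the coproduct of [Supl phi] unique; that of [tgtmod U] ensures that
   [rdual_cop phi] satisfies its characterizing equation. *)
- move=> phi; apply: (ldual_cop_unique ef) => u u'; apply: Supl_eval => v v'.
  exact: rdual_copP ef' _ _ _.
- exact: Supl_aug.
Qed.

Lemma Sdownr_rb_morphism (rU : right_hopf U)
    (fgs : fg_projective (srcmod U)) (fgt : fg_projective (tgtmod U)) :
  is_rb_morphism (ldual_bialgebroid fgs) (rdual_bialgebroid fgt) (Sdownr rU) id.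
Proof.
have [n [e [f ef]]] := srcmod_dual_basis fgs.
have [m [e' [f' ef']]] := tgtmod_dual_basis fgt.
split.
- exact: Sdownr_algmap.
- by [].
- exact: Sdownr_src.
- exact: Sdownr_tgt.
- move=> psi; apply: (rdual_cop_unique ef') => u u'; apply: Sdownr_eval => v v'.
  exact: ldual_copP ef _ _ _.
- exact: Sdownr_aug.
Qed.

(** * [S^*] and [S_*] are mutually inverse *)

Hypotheses (lU : left_hopf U) (rU : right_hopf U).

Lemma SuplK : cancel (Supl lU) (Sdownr rU).
Proof.
move=> phi; apply: rdualP => u /=; rewrite Sdown_actr.
have b := balanced_comp (actl_balanced lU phi) epslD.
rewrite (actr_unique rU b epslD) => [|v w]; first by rewrite actl1 // epsl_t.
rewrite /= Sup_actl -epslM_src -actl_mulcop // (tlift_comp epslD).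
by apply: eq_tlift => *; rewrite mulr1.
Qed.

(** Mirror of [SuplK]: [eps (actr psi w z)] solves the equation characterizing
    [eps (actl (Sdownr psi) w z)], and [z = 1] gives [psi w]. *)
Lemma SdownrK : cancel (Sdownr rU) (Supl lU).
Proof.
move=> psi; apply: ldualP => u /=; rewrite Sup_actl.
have b := balanced_comp (actr_balanced rU psi) epslD.
rewrite (actl_unique lU b epslD) => [|v w]; first by rewrite actr1 // epsl_s.
rewrite /= Sdown_actr -epslM_tgt -actr_mulcop // (tlift_comp epslD).
by apply: eq_tlift => *; rewrite mulr1.
Qed.

End Morphisms.

Theorem theoremB (k : comPzRingType) (A : algType k) (U : leftBialgebroid A) :
  [/\ (* (i) *)
      left_hopf U ->
      exists S : rdual U -> ldual U,
        [/\ forall (phi : rdual U) (u : U), S phi u = Sup phi u,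
            is_augAe_morphism (V := rdual_augAe U) (W := ldual_augAe U) S &
            forall (fgs : fg_projective (srcmod U)) (fgt : fg_projective (tgtmod U)),
              is_rb_morphism (rdual_bialgebroid fgt) (ldual_bialgebroid fgs) S id],
      (* (ii) *)
      right_hopf U ->
      exists S : ldual U -> rdual U,
        [/\ forall (psi : ldual U) (u : U), S psi u = Sdown psi u,
            is_augAe_morphism (V := ldual_augAe U) (W := rdual_augAe U) S &
            forall (fgs : fg_projective (srcmod U)) (fgt : fg_projective (tgtmod U)),
              is_rb_morphism (ldual_bialgebroid fgs) (rdual_bialgebroid fgt) S id] &
      (* (iii) *)
      left_hopf U -> right_hopf U ->
      (forall (S : rdual U -> ldual U) (S' : ldual U -> rdual U),
         (forall (phi : rdual U) (u : U), S phi u = Sup phi u) ->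
         (forall (psi : ldual U) (u : U), S' psi u = Sdown psi u) ->
         cancel S S' /\ cancel S' S) /\
      (forall (fgs : fg_projective (srcmod U)) (fgt : fg_projective (tgtmod U)),
         rb_isomorphic (rdual_bialgebroid fgt) (ldual_bialgebroid fgs))].
Proof.
split=> [lU|rU|lU rU].
- by exists (Supl lU); split=> [//||*]; [exact: Supl_augAe | exact: Supl_rb_morphism].
- by exists (Sdownr rU); split=> [//||*]; [exact: Sdownr_augAe | exact: Sdownr_rb_morphism].
split=> [S S' SE S'E|fgs fgt].
  (* Elements of the duals are determined by their values, so the two formulas determine [S] and
     [S']. *)
  have -> : S = Supl lU by apply: funext => phi; apply: ldualP => u; rewrite SE.
  have -> : S' = Sdownr rU by apply: funext => psi; apply: rdualP => u; rewrite S'E.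
  by split; [exact: SuplK | exact: SdownrK].
exists (Supl lU), id, (Sdownr rU), id; split=> //.
- exact: Supl_rb_morphism.
- exact: Sdownr_rb_morphism.
- by split; [exact: SuplK | exact: SdownrK].
Qed.
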